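(* Let $n \ge 2$ and $k \in \{1,\dots,n-1\}$. Let $K \in \mathcal{K}^n$ with $\mathcal{E}_L(K) = \mathbb{B}^n$, let $F \subset \mathbb{R}^n$ be a linear subspace of dimension $k$, and let $E \subset F$ be a $k$-ellipsoid with $K|F \subset E$. Then $$\mathrm{vol}_k(E) \ge \mathrm{vol}_k\left(\sqrt{\tfrac{k}{n}}\,\mathbb{B}^k\right),$$ with equality if and only if $E = \sqrt{\frac{k}{n}}\,(\mathbb{B}^n|F)$. Moreover, for every such $n$ and $k$ there exists a family of convex bodies $(K(t))_{t\in[0,1]}$ in $\mathcal{K}^n$, with $t \mapsto K(t)$ continuous with respect to the Hausdorff distance and $\mathcal{E}_L(K(t)) = \mathbb{B}^n$ for all $t$, which includes a regular cross-polytope and a cube, such that for every $t$ there exist a linear $k$-dimensional subspace $F_t$ and a Euclidean $k$-ball $E_t \subset F_t$ with $K(t)|F_t \subset E_t$ and $\mathrm{vol}_k(E_t) = \mathrm{vol}_k(\sqrt{k/n}\,\mathbb{B}^k)$. If $n$ is odd or $k \notin \{1,n-1\}$, then the family can be extended to a continuous family $(K(t))_{t \in [0,2]}$ with the same properties (Loewner ellipsoid equal to $\mathbb{B}^n$ and existence of $F_t, E_t$ for every $t\in[0,2]$) that in addition includes a regular simplex.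
   Context: $\mathcal{K}^n$ is the family of convex bodies in $\mathbb{R}^n$, i.e., compact convex sets with non-empty interior. $\mathbb{B}^n$ is the closed Euclidean unit ball in $\mathbb{R}^n$, and $\mathrm{vol}_k$ is $k$-dimensional volume. A $k$-ellipsoid is the image of $\mathbb{B}^k$ under an injective affine map $\mathbb{R}^k \to \mathbb{R}^n$; a Euclidean $k$-ball is a translate of a positive multiple of $\mathbb{B}^n \cap V$ for a $k$-dimensional linear subspace $V$. The Loewner ellipsoid $\mathcal{E}_L(K)$ of $K \in \mathcal{K}^n$ is the (unique) volume-minimal $n$-ellipsoid containing $K$. $X|F$ denotes the orthogonal projection of $X \subset \mathbb{R}^n$ onto the linear subspace $F$. *)

(* Defs.v *)
From HB Require Import structures.
From mathcomp Require Import all_boot all_order all_algebra.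
From mathcomp Require Import all_classical all_reals all_analysis.

Set Implicit Arguments.
Unset Strict Implicit.
Unset Printing Implicit Defensive.

Import Order.TTheory GRing.Theory Num.Theory.
Import numFieldNormedType.Exports.

Local Open Scope classical_set_scope.
Local Open Scope ring_scope.

(* R^n is ['rV[R]_n] for a [realType] R.  The library norm on matrices is the
   sup norm: it induces the usual topology, hence the usual compact sets and
   interiors, but every metric notion below uses the Euclidean norm [enorm]. *)

Definition dot (R : realType) (n : nat) (u v : 'rV[R]_n) : R :=
  \sum_(j < n) u ord0 j * v ord0 j.

Definition enorm (R : realType) (n : nat) (u : 'rV[R]_n) : R :=
  Num.sqrt (dot u u).

Definition unit_ball (R : realType) (n : nat) : set 'rV[R]_n :=
  [set x | enorm x <= 1].
Arguments unit_ball : clear implicits.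

Definition dilate (R : realType) (n : nat) (r : R) (X : set 'rV[R]_n) :
    set 'rV[R]_n := [set r *: x | x in X].

Definition convex_body (R : realType) (n : nat) (K : set 'rV[R]_n) : Prop :=
  [/\ compact K, convex_set K & K° !=set0].

Definition is_ellipsoid (R : realType) (n k : nat) (E : set 'rV[R]_n) : Prop :=
  exists (f : {linear 'rV[R]_k -> 'rV[R]_n}) (c : 'rV[R]_n),
    injective f /\ E = [set c + f x | x in unit_ball R k].

Definition is_euclidean_ball (R : realType) (n k : nat) (E : set 'rV[R]_n) :
    Prop :=
  exists (V : {vspace 'rV[R]_n}) (c : 'rV[R]_n) (r : R),
    [/\ \dim V = k, 0 < r &
        E = [set c + x | x in dilate r (unit_ball R n `&` [set` V])]].

Definition orth_proj (R : realType) (n : nat) (F : {vspace 'rV[R]_n})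
    (X : set 'rV[R]_n) : set 'rV[R]_n :=
  [set y | y \in F /\
     exists2 x, X x & forall z, z \in F -> dot (x - y) z = 0].

Definition box (R : realType) (k : nat) (a b : 'rV[R]_k) : set 'rV[R]_k :=
  [set x | forall j, a ord0 j <= x ord0 j <= b ord0 j].

(* Lebesgue (outer) measure on R^k: infimum of the total volumes of the
   countable coverings by boxes. *)
Definition lebesgue (R : realType) (k : nat) (A : set 'rV[R]_k) : \bar R :=
  ereal_inf [set v | exists a b : nat -> 'rV[R]_k,
    [/\ forall i j, a i ord0 j <= b i ord0 j,
        A `<=` \bigcup_i box (a i) (b i) &
        v = (\sum_(0 <= i <oo)
               (\prod_(j < k) (b i ord0 j - a i ord0 j))%:E)%E]].

(* k-dimensional volume in R^n of a set X contained in a k-flat: the Lebesgue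
   measure of X read in isometric coordinates u |-> c + u *m A of a k-flat
   containing X (the rows of A are orthonormal).  It does not depend on the
   coordinates, Lebesgue measure being invariant under rigid motions, so that
   the infimum only avoids choosing them.  It is +oo if no k-flat contains X. *)
Definition vol (R : realType) (n k : nat) (X : set 'rV[R]_n) : \bar R :=
  ereal_inf [set v | exists (A : 'M[R]_(k, n)) (c : 'rV[R]_n),
    [/\ A *m A^T = 1%:M,
        X `<=` range (fun u : 'rV[R]_k => c + u *m A) &
        v = lebesgue [set u : 'rV[R]_k | X (c + u *m A)]]].

(* E is a volume-minimal n-ellipsoid containing K; for a convex body K there is
   exactly one. *)
Definition is_loewner (R : realType) (n : nat) (K E : set 'rV[R]_n) : Prop :=
  [/\ is_ellipsoid n E, K `<=` E &
      forall E' : set 'rV[R]_n, is_ellipsoid n E' -> K `<=` E' ->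
        (lebesgue E <= lebesgue E')%E].

(* For nonempty bounded K and L, the set under the infimum is nonempty, and
   its elements are the e >= 0 such that K is included in L + e B^n and
   L in K + e B^n. *)
Definition hausdorff_dist (R : realType) (n : nat) (K L : set 'rV[R]_n) : R :=
  inf [set e : R | [/\ 0 <= e,
    forall x, K x -> exists2 y, L y & enorm (x - y) <= e &
    forall y, L y -> exists2 x, K x & enorm (x - y) <= e]].

Definition hausdorff_continuous (R : realType) (n : nat) (D : set R)
    (K : R -> set 'rV[R]_n) : Prop :=
  forall t, D t ->
    hausdorff_dist (K s) (K t) @[s --> within D (nbhs t)] --> (0 : R).

Definition conv_hull (R : realType) (n : nat) (I : finType)
    (p : I -> 'rV[R]_n) : set 'rV[R]_n :=
  [set x | exists w : I -> R,
    [/\ forall i, 0 <= w i, \sum_i w i = 1 & x = \sum_i w i *: p i]].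

(* In the next two definitions, the rows of U form an orthonormal basis. *)
Definition is_regular_crosspolytope (R : realType) (n : nat)
    (K : set 'rV[R]_n) : Prop :=
  exists (U : 'M[R]_n) (c : 'rV[R]_n) (r : R),
    [/\ U *m U^T = 1%:M, 0 < r &
        K = conv_hull (fun ib : 'I_n * bool =>
                         c + ((-1) ^+ ib.2 * r) *: row ib.1 U)].

Definition is_cube (R : realType) (n : nat) (K : set 'rV[R]_n) : Prop :=
  exists (U : 'M[R]_n) (c : 'rV[R]_n) (r : R),
    [/\ U *m U^T = 1%:M, 0 < r &
        K = [set c + x *m U | x in
               [set x : 'rV[R]_n | forall j, `|x ord0 j| <= r]]].

Definition is_regular_simplex (R : realType) (n : nat)
    (K : set 'rV[R]_n) : Prop :=
  exists (p : 'I_n.+1 -> 'rV[R]_n) (d : R),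
    [/\ 0 < d, forall i j, i != j -> enorm (p i - p j) = d &
        K = conv_hull p].

Definition extremal_family (R : realType) (n k : nat) (D : set R)
    (K : R -> set 'rV[R]_n) : Prop :=
  [/\ forall t, D t -> convex_body (K t),
      hausdorff_continuous D K,
      forall t, D t -> is_loewner (K t) (unit_ball R n) &
      forall t, D t ->
        exists (F : {vspace 'rV[R]_n}) (E : set 'rV[R]_n),
          [/\ \dim F = k, E `<=` [set` F], is_euclidean_ball k E,
              orth_proj F (K t) `<=` E &
              vol k E =
                lebesgue (dilate (Num.sqrt (k%:R / n%:R)) (unit_ball R k))]].

(* Main.v *)
Require Import Defs.
From HB Require Import structures.
From mathcomp Require Import all_boot all_order all_algebra.
From mathcomp Require Import all_classical all_reals all_analysis.
From mathcomp Require Import measurable_realfun zify ring lra.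

(** Why the theorem holds.

    Let the unit ball be the Loewner ellipsoid of [K], and let the projection of
    [K] to a [k]-dimensional subspace lie in the ellipsoid
    [|(x A^T) S - b| <= 1], where the rows of [A] are an orthonormal basis of the
    subspace. If [u i] are the contact points of [K] with the sphere and [lam i]
    are the weights of John's decomposition of the identity, then summing
    [|(u i A^T) S - b| ^ 2 <= 1] gives [tr (S^T S) + n |b| ^ 2 <= n]. The
    inequality between the arithmetic and the geometric mean, in the form
    [det S ^ 2 <= (tr (S^T S) / k) ^ k], turns this into the volume bound, and its
    equality case into [S^T S = (n / k) 1] and [b = 0].

    The trace inequality is obtained here directly from the minimality of the
    ball, without contact points ([loewner_trace_le]): if it failed, one could
    perturb the ball to an ellipsoid that still contains [K] and is smaller to
    first order. A triangular choice of the perturbation keeps all determinants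
    explicit; triangular factors also give the arithmetic-geometric inequality
    ([det_le_trace], [det_eq_trace]) and the volume of ellipsoids. For the latter
    Lebesgue outer measure, defined by coverings with boxes, is shown to be
    subadditive ([lebesgue_bigcup]), to be scaled by the determinant under
    triangular maps, which are compositions of shears and dilations of one
    coordinate ([triangular_scales_lebesgue]), and to be positive on the ball
    ([cover_cube_integrated]).

    For the family, fix a subspace and let the slab be the set of all points of
    the unit ball with a projection of length at most [sqrt (k / n)]. A convex
    body in the slab that satisfies John's condition has the unit ball as its
    Loewner ellipsoid ([john_is_loewner]) and is extremal. Two such bodies are
    joined by Minkowski combinations with the slab: these stay in the slab, they
    contain one of the two bodies and thus its contact points, and they depend in
    a Lipschitz way on the coefficients ([path_hausdorff]). It remains to place a
    cross-polytope, a cube and, where it exists, a simplex in the slab. For the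
    cube the subspace is a coordinate subspace. The cross-polytope requires [n]
    vectors of equal length in dimension [k] that form a tight frame, and the
    simplex requires [n + 1] such vectors with sum zero; they are assembled
    from the discrete harmonics [cos (2 pi i j / N)] and [sin (2 pi i j / N)]
    ([tight_frame_exists], [zero_sum_frame_exists]). *)

Set Implicit Arguments.
Unset Strict Implicit.
Unset Printing Implicit Defensive.

Import Order.TTheory GRing.Theory Num.Theory.
Import numFieldNormedType.Exports.

Local Open Scope classical_set_scope.
Local Open Scope ring_scope.

(** * Euclidean geometry of row vectors *)

Section EuclideanSpace.
Variable R : realType.

Lemma dotE n (u v : 'rV[R]_n) : dot u v = (u *m v^T) 0 0.
Proof. by rewrite mxE; apply: eq_bigr => j _; rewrite mxE. Qed.

Lemma dot_mx n (u v : 'rV[R]_n) : u *m v^T = (dot u v)%:M.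
Proof. by rewrite [LHS]mx11_scalar -dotE. Qed.

Lemma dotC n (u v : 'rV[R]_n) : dot u v = dot v u.
Proof. by apply: eq_bigr => j _; rewrite mulrC. Qed.

Lemma dotDl n (u v w : 'rV[R]_n) : dot (u + v) w = dot u w + dot v w.
Proof. by rewrite !dotE mulmxDl mxE. Qed.

Lemma dotDr n (u v w : 'rV[R]_n) : dot w (u + v) = dot w u + dot w v.
Proof. by rewrite dotC dotDl !(dotC w). Qed.

Lemma dotZl n a (u v : 'rV[R]_n) : dot (a *: u) v = a * dot u v.
Proof. by rewrite !dotE -scalemxAl mxE. Qed.

Lemma dotZr n a (u v : 'rV[R]_n) : dot u (a *: v) = a * dot u v.
Proof. by rewrite dotC dotZl dotC. Qed.

Lemma dotNl n (u v : 'rV[R]_n) : dot (- u) v = - dot u v.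
Proof. by rewrite -scaleN1r dotZl mulN1r. Qed.

Lemma dotNr n (u v : 'rV[R]_n) : dot u (- v) = - dot u v.
Proof. by rewrite dotC dotNl dotC. Qed.

Lemma dot0l n (u : 'rV[R]_n) : dot 0 u = 0.
Proof. by rewrite -[0](scale0r 0) dotZl mul0r. Qed.

Lemma dot_suml n I (r : seq I) (P : pred I) (u : I -> 'rV[R]_n) v :
  dot (\sum_(i <- r | P i) u i) v = \sum_(i <- r | P i) dot (u i) v.
Proof.
elim/big_rec2: _ => [|i y x _ <-]; [exact: dot0l | exact: dotDl].
Qed.

Lemma dot_mull m n (u : 'rV[R]_m) (A : 'M[R]_(m, n)) v :
  dot (u *m A) v = dot u (v *m A^T).
Proof. by rewrite !dotE trmx_mul trmxK mulmxA. Qed.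

Lemma dotB n (u v : 'rV[R]_n) :
  dot (u - v) (u - v) = dot u u - dot u v *+ 2 + dot v v.
Proof. by rewrite !(dotDl, dotDr, dotNl, dotNr) (dotC v u); ring. Qed.

Lemma dot_ge0 n (u : 'rV[R]_n) : 0 <= dot u u.
Proof. by apply: sumr_ge0 => j _; rewrite -expr2 sqr_ge0. Qed.

Lemma dot_eq0 n (u : 'rV[R]_n) : (dot u u == 0) = (u == 0).
Proof.
apply/eqP/eqP => [|->]; last exact: dot0l.
move=> /psumr_eq0P u0; apply/rowP => j; rewrite mxE; apply/eqP.
by rewrite -sqrf_eq0 expr2 u0 // => i _; rewrite -expr2 sqr_ge0.
Qed.

Lemma dot_orthonormal m n (A : 'M[R]_(m, n)) (u v : 'rV_m) :
  A *m A^T = 1%:M -> dot (u *m A) (v *m A) = dot u v.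
Proof. by move=> AA; rewrite dot_mull -mulmxA AA mulmx1. Qed.

Lemma dot_row m n (A B : 'M[R]_(m, n)) i j :
  dot (row i A) (row j B) = (A *m B^T) i j.
Proof. by rewrite mxE; apply: eq_bigr => l _; rewrite !mxE. Qed.

Lemma enorm_ge0 n (u : 'rV[R]_n) : 0 <= enorm u.
Proof. exact: sqrtr_ge0. Qed.

Lemma sqr_enorm n (u : 'rV[R]_n) : enorm u ^+ 2 = dot u u.
Proof. by rewrite sqr_sqrtr ?dot_ge0. Qed.

Lemma enorm_le n (u : 'rV[R]_n) r : 0 <= r -> (enorm u <= r) = (dot u u <= r ^+ 2).
Proof. by move=> r0; rewrite -sqr_enorm ler_sqr ?nnegrE ?enorm_ge0. Qed.

Lemma unit_ballE n (u : 'rV[R]_n) : unit_ball R n u = (dot u u <= 1).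
Proof. by rewrite /unit_ball /= enorm_le // expr1n. Qed.

Lemma enormZ n a (u : 'rV[R]_n) : enorm (a *: u) = `|a| * enorm u.
Proof.
by rewrite /enorm dotZl dotZr mulrA -expr2 sqrtrM ?sqr_ge0 // sqrtr_sqr.
Qed.

Lemma enormN n (u : 'rV[R]_n) : enorm (- u) = enorm u.
Proof. by rewrite -scaleN1r enormZ normrN1 mul1r. Qed.

Lemma enorm0 n : enorm (0 : 'rV[R]_n) = 0.
Proof. by rewrite /enorm dot0l sqrtr0. Qed.

(** Cauchy-Schwarz: expand the square norm of [|v| u - |u| v]. *)
Lemma dot_le_enorm n (u v : 'rV[R]_n) : dot u v <= enorm u * enorm v.
Proof.
have [|u0] := eqVneq (enorm u) 0.
  move=> /(congr1 (fun x => x ^+ 2)); rewrite sqr_enorm expr0n /= => /eqP.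
  by rewrite dot_eq0 => /eqP ->; rewrite dot0l mulr_ge0 ?enorm_ge0.
have [|v0] := eqVneq (enorm v) 0.
  move=> /(congr1 (fun x => x ^+ 2)); rewrite sqr_enorm expr0n /= => /eqP.
  by rewrite dot_eq0 => /eqP ->; rewrite dotC dot0l mulr_ge0 ?enorm_ge0.
have := dot_ge0 (enorm v *: u - enorm u *: v).
rewrite dotB !dotZl !dotZr -!sqr_enorm (_ : _ + _ =
  2 * ((enorm u * enorm v) * (enorm u * enorm v - dot u v))); last by ring.
rewrite pmulr_rge0 //.
rewrite pmulr_rge0 ?subr_ge0 //.
by rewrite mulr_gt0 // lt_neqAle eq_sym ?u0 ?v0 enorm_ge0.
Qed.

Lemma enorm_triangle n (u v : 'rV[R]_n) : enorm (u + v) <= enorm u + enorm v.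
Proof.
rewrite enorm_le ?addr_ge0 ?enorm_ge0 // dotDl !dotDr (dotC v u) -!sqr_enorm.
have := dot_le_enorm u v; lra.
Qed.

Lemma le_coord_enorm n (u : 'rV[R]_n) j : `|u 0 j| <= enorm u.
Proof.
rewrite -sqrtr_sqr ler_sqrt ?dot_ge0 // /dot (bigD1 j) //= expr2 lerDl.
by apply: sumr_ge0 => i _; rewrite -expr2 sqr_ge0.
Qed.

End EuclideanSpace.

(** * Orthonormal rows, triangular factors and determinants *)

Section Orthonormal.
Variable R : realType.

(** A Gram-Schmidt step: for dimension reasons the row space of [U] meets the
    orthogonal complement of the rows of [G]. *)
Lemma orthonormal_step k m n (G : 'M[R]_(k, n)) (U : 'M[R]_(m, n)) :
  (k < \rank U)%N ->
  exists v : 'rV[R]_n, [/\ v *m v^T = 1%:M, G *m v^T = 0 & (v <= U)%MS].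
Proof.
move=> kU.
have : (U :&: kermx G^T)%MS != 0.
  rewrite -mxrank_eq0 -lt0n.
  have := mxrank_sum_cap U (kermx G^T); rewrite mxrank_ker mxrank_tr.
  have := rank_leq_col (U + kermx G^T)%MS; have := rank_leq_row G.
  move: (\rank (U + kermx G^T)%MS) (\rank (U :&: kermx G^T)%MS) (\rank G) => a b c.
  move: (\rank U) kU => d; lia.
case/rowV0Pn => v; rewrite sub_capmx => /andP[vU /sub_kermxP vG] v0.
have d0 : enorm v != 0.
  apply: contra v0 => /eqP v0; rewrite -dot_eq0 -sqr_enorm v0.
  by rewrite expr0n.
exists ((enorm v)^-1 *: v); split.
- rewrite dot_mx dotZl dotZr -sqr_enorm; congr (_ %:M).
  by field.
- by rewrite linearZ /= -scalemxAr -[G *m _]trmxK trmx_mul trmxK vG trmx0 scaler0.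
- exact: scalemx_sub.
Qed.

Lemma orthonormal_extend d k m n (G : 'M[R]_(k, n)) (U : 'M[R]_(m, n)) :
  (k + d)%N = \rank U ->
  exists G' : 'M[R]_(d, n), [/\ G' *m G'^T = 1%:M, G *m G'^T = 0 & (G' <= U)%MS].
Proof.
elim: d k G => [|d IH] k G kd.
  exists 0; split; [by apply/matrixP => -[] | | exact: sub0mx].
  by apply/matrixP => i [].
have [|v [vv Gv vU]] := @orthonormal_step _ _ _ G U; first by rewrite -kd; lia.
have [|G' [GG /eqP]] := IH _ (col_mx G v); first by rewrite -kd addn1 addSnnS.
rewrite mul_col_mx col_mx_eq0 => /andP[/eqP G'G /eqP G'v] G'U.
change (exists G' : 'M[R]_(1 + d, n),
  [/\ G' *m G'^T = 1%:M, G *m G'^T = 0 & (G' <= U)%MS]).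
exists (col_mx v G'); split.
- rewrite tr_col_mx mul_col_row vv GG G'v.
  by rewrite -[G' *m _]trmxK trmx_mul trmxK G'v trmx0 -scalar_mx_block.
- by rewrite tr_col_mx mul_mx_row Gv G'G row_mx0.
- by rewrite col_mx_sub vU.
Qed.

Lemma row_space_orthonormal k m n (U : 'M[R]_(m, n)) : \rank U = k ->
  exists A : 'M[R]_(k, n), A *m A^T = 1%:M /\ (A == U)%MS.
Proof.
move=> rU; have [|A [AA _ AU]] := @orthonormal_extend k 0 _ _ 0 U; first by rewrite rU.
exists A; split => //.
have rA : \rank A = k.
  apply/eqP; rewrite eqn_leq rank_leq_row /=.
  by have := mxrankM_maxl A A^T; rewrite AA mxrank1.
by rewrite -(mxrank_leqif_eq AU) rA rU.
Qed.

Lemma orthogonal_complete k d n (G : 'M[R]_(k, n)) :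
  (k + d)%N = n -> G *m G^T = 1%:M ->
  exists G' : 'M[R]_(d, n),
   [/\ G' *m G'^T = 1%:M, G *m G'^T = 0 & G^T *m G + G'^T *m G' = 1%:M].
Proof.
move=> kd GG.
have [|G' [G'G' GG' _]] := @orthonormal_extend d k n n G 1%:M.
  by rewrite mxrank1.
exists G'; split=> //; subst n; rewrite -mul_row_col -tr_col_mx.
apply: mulmx1C; rewrite tr_col_mx mul_col_row GG GG' G'G'.
by rewrite -[G' *m _]trmxK trmx_mul trmxK GG' trmx0 -scalar_mx_block.
Qed.

(** The witness [Q] has the normalized first column of [T] as its first row, so
    that its other rows are orthogonal to that column. *)
Lemma orthogonal_clear_column n (T : 'M[R]_(1 + n)) :
  exists (Q : 'M[R]_(1 + n)) (a : 'M[R]_1) r T',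
    Q *m Q^T = 1%:M /\ Q *m T = block_mx a r 0 T'.
Proof.
pose t := (lsubmx T)^T : 'rV[R]_(1 + n).
have [t0|t0] := eqVneq t 0.
  exists 1%:M, (ulsubmx T), (ursubmx T), (drsubmx T).
  rewrite trmx1 mulmx1; split => //.
  have <- : dlsubmx T = 0.
    apply/matrixP => i j; rewrite !mxE.
    by have := congr1 (fun u : 'rV_(1 + n) => u j (rshift 1 i)) t0; rewrite !mxE => ->.
  by rewrite mul1mx submxK.
have d0 : enorm t != 0.
  by apply: contra t0 => /eqP t0; rewrite -dot_eq0 -sqr_enorm t0 expr0n.
pose v := (enorm t)^-1 *: t.
have vv : v *m v^T = 1%:M.
  by rewrite dot_mx dotZl dotZr -sqr_enorm; congr (_ %:M); field.
have [G [GG vG _]] := @orthogonal_complete 1 n (1 + n) v erefl vv.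
have Gv : G *m v^T = 0 by rewrite -[LHS]trmxK trmx_mul trmxK vG trmx0.
exists (col_mx v G), (v *m t^T), (v *m rsubmx T), (G *m rsubmx T); split.
  by rewrite tr_col_mx mul_col_row vv vG Gv GG -scalar_mx_block.
rewrite -[X in _ *m X = _](@hsubmxK _ _ 1 n) mul_col_mx !mul_mx_row.
have -> : lsubmx T = t^T by rewrite trmxK.
rewrite /block_mx; congr (col_mx _ (row_mx _ _)).
have -> : t = enorm t *: v by rewrite scalerA divff // scale1r.
by rewrite linearZ /= -scalemxAr Gv scaler0.
Qed.

Lemma QR_decomposition n (T : 'M[R]_n) : exists Q U : 'M[R]_n,
  [/\ T = Q *m U, Q *m Q^T = 1%:M & forall i j : 'I_n, (j < i)%N -> U i j = 0].
Proof.
elim: n T => [|n IH] T.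
  by exists 1%:M, T; rewrite mul1mx trmx1 mul1mx; split => // -[].
have [Q1 [a [r [T' [Q1Q1 Q1T]]]]] := @orthogonal_clear_column n T.
have [Q [U [T'E QQ Utri]]] := IH T'.
change (exists Q U : 'M[R]_(1 + n), [/\ T = Q *m U, Q *m Q^T = 1%:M &
  forall i j : 'I_(1 + n), (j < i)%N -> U i j = 0]).
exists (Q1^T *m block_mx (1%:M : 'M[R]_1) 0 0 Q), (block_mx a r 0 U); split.
- rewrite -mulmxA mulmx_block !(mul0mx, mulmx0, mul1mx, add0r, addr0) -T'E.
  by rewrite -Q1T mulmxA (mulmx1C Q1Q1) mul1mx.
- rewrite trmx_mul trmxK mulmxA -[_ *m _ *m (block_mx _ _ _ _)^T]mulmxA.
  rewrite tr_block_mx mulmx_block !(trmx0, trmx1, mul0mx, mulmx0, mul1mx, add0r, addr0).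
  by rewrite QQ -scalar_mx_block mulmx1 (mulmx1C Q1Q1).
- move=> i j; case: (split_ordP i) => i' ->; case: (split_ordP j) => j' -> /=.
  + by rewrite !ord1.
  + by rewrite (ord1 i').
  + by rewrite block_mxEdl mxE.
  + by rewrite block_mxEdr ltn_add2l; apply: Utri.
Qed.

Lemma det_upper_tri n (U : 'M[R]_n) :
  (forall i j : 'I_n, (j < i)%N -> U i j = 0) -> \det U = \prod_i U i i.
Proof.
move=> Utri; rewrite -det_tr det_trig.
  by apply: eq_bigr => i _; rewrite mxE.
by apply/is_trig_mxP => i j ij; rewrite mxE Utri.
Qed.

Lemma sqr_det_orthogonal n (Q : 'M[R]_n) : Q *m Q^T = 1%:M -> \det Q ^+ 2 = 1.
Proof. by move=> QQ; rewrite expr2 -{2}det_tr -det_mulmx QQ det1. Qed.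

Lemma mxtrace_tr_mul m n (U : 'M[R]_(m, n)) : \tr (U^T *m U) = \sum_j \sum_i U i j ^+ 2.
Proof.
by apply: eq_bigr => j _; rewrite mxE; apply: eq_bigr => i _; rewrite mxE expr2.
Qed.

(** The arithmetic-geometric inequality for the eigenvalues of [T^T T], read
    off a triangular factor: its squared diagonal entries have product
    [det T ^ 2] and sum at most the trace. *)
Lemma det_le_trace n (T : 'M[R]_n) :
  \det T ^+ 2 <= (\tr (T^T *m T) / n%:R) ^+ n.
Proof.
have [Q [U [-> QQ Utri]]] := QR_decomposition T.
rewrite trmx_mul mulmxA -[_ *m Q^T *m Q]mulmxA (mulmx1C QQ) mulmx1.
rewrite det_mulmx exprMn sqr_det_orthogonal // mul1r det_upper_tri //.
rewrite -prodrXl.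
have := @leif_AGM R 'I_n predT (fun i => U i i ^+ 2) (fun i _ => sqr_ge0 _).
move=> /leifP; rewrite card_ord => h.
apply: le_trans (_ : ((\sum_(i < n) U i i ^+ 2) / n%:R) ^+ n <= _).
  by case: ifP h => _ => [/eqP ->|/ltW].
have D0 : 0 <= \sum_(i < n) U i i ^+ 2 by apply: sumr_ge0 => i _; exact: sqr_ge0.
suff DU : \sum_(i < n) U i i ^+ 2 <= \tr (U^T *m U).
  rewrite lerXn2r ?nnegrE ?divr_ge0 ?ler0n ?(le_trans D0) //.
  by rewrite ler_wpM2r ?invr_ge0 ?ler0n.
rewrite mxtrace_tr_mul ler_sum // => j _.
by rewrite (bigD1 j) //= lerDl sumr_ge0 // => i _; rewrite sqr_ge0.
Qed.

(** In the equality case the diagonal of the triangular factor is constant up to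
    signs, and its squares already exhaust the trace, so that the factor is
    diagonal. *)
Lemma det_eq_trace n (T : 'M[R]_n) (s : R) : (0 < n)%N -> 0 < s ->
  \tr (T^T *m T) <= s * n%:R -> \det T ^+ 2 = s ^+ n -> T^T *m T = s%:M.
Proof.
move=> n0 s0; have [Q [U [-> QQ Utri]]] := QR_decomposition T.
rewrite trmx_mul mulmxA -[_ *m Q^T *m Q]mulmxA (mulmx1C QQ) mulmx1.
rewrite det_mulmx exprMn sqr_det_orthogonal // mul1r det_upper_tri // -prodrXl.
move=> trU detU.
have nR : (0 : R) < n%:R by rewrite ltr0n.
pose D := \sum_(i < n) U i i ^+ 2.
have trE : \tr (U^T *m U) = D + \sum_j \sum_(i | i != j) U i j ^+ 2.
  rewrite mxtrace_tr_mul -big_split /=; apply: eq_bigr => j _.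
  by rewrite (bigD1 j).
have off0 : 0 <= \sum_j \sum_(i | i != j) U i j ^+ 2.
  by apply: sumr_ge0 => j _; apply: sumr_ge0 => i _; rewrite sqr_ge0.
have D0 : 0 <= D by apply: sumr_ge0 => i _; rewrite sqr_ge0.
have := @leif_AGM R 'I_n predT (fun i => U i i ^+ 2) (fun i _ => sqr_ge0 _).
rewrite card_ord -/D [\prod_(i in _) _]detU => agm.
have Dn : s * n%:R <= D.
  rewrite -ler_pdivlMr // -(@ler_pXn2r _ n) ?nnegrE ?divr_ge0 ?(ltW s0) ?(ltW nR) //.
  by case: agm.
have DE : D = s * n%:R by apply/eqP; rewrite eq_le Dn andbT; apply: le_trans trU; rewrite trE lerDl.
have offE : \sum_j \sum_(i | i != j) U i j ^+ 2 = 0.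
  by apply/eqP; rewrite eq_le off0 andbT; move: trU; rewrite trE DE gerDl.
have Uoff i j : i != j -> U i j = 0.
  move=> ij; apply/eqP; rewrite -sqrf_eq0.
  have colE : \sum_(l | l != j) U l j ^+ 2 = 0.
    move/psumr_eq0P: offE => -> // l _.
    by apply: sumr_ge0 => m _; exact: sqr_ge0.
  by move/psumr_eq0P: colE => -> // l _; exact: sqr_ge0.
have Ueq i j : U i i ^+ 2 = U j j ^+ 2.
  case: agm => _; rewrite DE mulfK ?(gt_eqF nR) // eqxx => /esym/forall_inP h.
  by have /forall_inP /(_ j isT) /eqP := h i isT.
apply/matrixP => i j; rewrite !mxE (bigD1 i) //= big1 ?addr0; last first.
  by move=> l li; rewrite mxE Uoff ?mul0r.
rewrite mxE; have [<-|ij] := eqVneq i j; last by rewrite (Uoff i j) // mulr0.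
rewrite mulr1n -expr2; apply: (@mulIf _ n%:R); first by rewrite (gt_eqF nR).
rewrite -DE /D (eq_bigr (fun=> U i i ^+ 2)) => [|l _]; last exact: Ueq.
by rewrite sumr_const card_ord mulr_natr.
Qed.

End Orthonormal.

(** * Lebesgue outer measure *)

Section LebesgueOuterMeasure.
Variables (R : realType) (k : nat).
Implicit Types (a b : 'rV[R]_k) (X Y : set 'rV[R]_k).
Local Open Scope ereal_scope.

Definition box_vol a b : R := (\prod_(j < k) (b ord0 j - a ord0 j))%R.

Lemma box_vol_ge0 a b : (forall j, a ord0 j <= b ord0 j)%R -> (0 <= box_vol a b)%R.
Proof. by move=> ab; apply: prodr_ge0 => j _; rewrite subr_ge0. Qed.

Lemma lebesgue_ge0 X : 0 <= lebesgue X.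
Proof.
apply: le_ereal_inf_tmp => _ [a [b [ab _ ->]]].
by apply: nneseries_ge0 => i _ _; rewrite lee_fin box_vol_ge0.
Qed.

Lemma le_lebesgue X Y : X `<=` Y -> lebesgue X <= lebesgue Y.
Proof.
move=> XY; apply: ereal_inf_le_tmp => _ [a [b [ab Yab ->]]].
by exists a, b; split => //; apply: subset_trans Yab.
Qed.

(** Almost optimal coverings of the sets [A n], with errors [e / 2 ^ (n + 1)],
    are merged along a bijection between [nat] and [nat * nat]. *)
Lemma lebesgue_bigcup (A : nat -> set 'rV[R]_k) :
  lebesgue (\bigcup_i A i) <= \sum_(i <oo) lebesgue (A i).
Proof.
have [[i ioo]|] := pselect (exists i, lebesgue (A i) = +oo).
  rewrite (eseries_pinfty _ _ ioo) ?leey// => n _.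
  by rewrite -ltNye (lt_le_trans _ (lebesgue_ge0 _)).
rewrite -forallNE => Aoo; apply/lee_addgt0Pr => e e0.
rewrite (le_trans _ (epsilon_trick _ _ (ltW e0)))//; last first.
  by move=> n; exact: lebesgue_ge0.
pose P n (B : nat -> 'rV[R]_k * 'rV[R]_k) :=
  [/\ forall i j, ((B i).1 ord0 j <= (B i).2 ord0 j)%R,
      A n `<=` \bigcup_i box (B i).1 (B i).2 &
   \sum_(i <oo) (box_vol (B i).1 (B i).2)%:E
     <= lebesgue (A n) + (e / (2 ^ n.+1)%:R)%:E].
have [G PG] : {G : nat -> nat -> 'rV[R]_k * 'rV[R]_k & forall n, P n (G n)}.
  apply: (@boolp.choice _ _ P) => n; rewrite /P.
  have en1 : (0 < e / (2 ^ n.+1)%:R)%R by rewrite divr_gt0.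
  have fin : lebesgue (A n) \is a fin_num.
    by rewrite ge0_fin_numE ?lebesgue_ge0 // ltey; apply/eqP/Aoo.
  have [_ [a [b [ab Aab ->]]] le] := lb_ereal_inf_adherent en1 fin.
  by exists (fun i => (a i, b i)); split => //; exact: ltW le.
pose v (p : nat * nat) := (box_vol (G p.1 p.2).1 (G p.1 p.2).2)%:E : \bar R.
have v0 p : 0 <= v p by rewrite lee_fin box_vol_ge0 //; case: (PG p.1).
have /card_esym/ppcard_eqP[f] := card_nat2.
apply: (@le_trans _ _ (\esum_(p in setT) v p)).
  apply: ereal_inf_lbound => /=.
  exists (fun i => (G (f i).1 (f i).2).1), (fun i => (G (f i).1 (f i).2).2).
  split => [i j||]; first by case: (PG (f i).1).
    move=> x [n _ /(let: And3 _ h _ := PG n in h) [m _ xnm]].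
    by exists (f^-1%FUN (n, m)) => //=; rewrite invK ?inE.
  rewrite [RHS](_ : _ = \sum_(i <oo) v (f i)) //.
  have finj : set_inj xpredT f.
    by move=> i j _ _ /(congr1 f^-1%FUN); rewrite !funK ?inE.
  rewrite -(esum_pred_image v _ xpredT) //.
  by congr esum; apply/seteqP; split => // p _; exists (f^-1%FUN p); rewrite ?invK ?inE.
rewrite (_ : esum _ _ = \sum_(n <oo) \sum_(m <oo) v (n, m)); last first.
  pose J : nat -> set (nat * nat) := fun n => [set (n, m) | m in setT].
  rewrite (_ : setT = \bigcup_n J n); last first.
    by rewrite predeqE => -[n m]; split => // _; exists n => //; exists m.
  rewrite esum_bigcupT //; last first.
    apply/trivIsetP => i j _ _ ij.
    rewrite predeqE => -[n m] /=; split => //= -[] [_] _ [<-{n} _].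
    by move=> [m' _] [] /esym/eqP; rewrite (negbTE ij).
  rewrite -(image_id [set: nat]) -fun_true esum_pred_image//; last first.
    by move=> n _; exact: esum_ge0.
  apply: eq_eseriesr => /= n _.
  rewrite -(esum_pred_image v (pair n) predT)//=; last first.
    by move=> ? ? _ _; exact: (@can_inj _ _ _ snd).
  by congr esum; rewrite predeqE => -[? ?]; split; move=> [m _ <-]; exists m.
apply: lee_nneseries => [n _ _|n _]; first exact: nneseries_ge0.
by case: (PG n).
Qed.

(** By subadditivity a bound on the images of boxes passes to the images of all
    sets. *)
Lemma lebesgue_image_le (f : 'rV[R]_k -> 'rV[R]_k) (d : R) : (0 < d)%R ->
  (forall a b, (forall j, a ord0 j <= b ord0 j)%R ->
     lebesgue (f @` box a b) <= (d * box_vol a b)%:E) ->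
  forall X, lebesgue (f @` X) <= d%:E * lebesgue X.
Proof.
move=> d0 fbox X; rewrite -lee_pdivrMl //.
apply: le_ereal_inf_tmp => _ [a [b [ab Xab ->]]]; rewrite lee_pdivrMl //.
rewrite -nneseriesZl ?lee_fin ?(ltW d0) //; last first.
  by move=> i _; rewrite lee_fin box_vol_ge0.
apply: (@le_trans _ _ (lebesgue (\bigcup_i f @` box (a i) (b i)))).
  by apply: le_lebesgue => _ [x /Xab [i _ xi] <-]; exists i.
apply: le_trans (lebesgue_bigcup _) _.
apply: lee_nneseries => [i _ _|i _]; first exact: lebesgue_ge0.
by rewrite -EFinM fbox.
Qed.

Hypothesis k_gt0 : (0 < k)%N.

Lemma lebesgue_box a b : (forall j, a ord0 j <= b ord0 j)%R ->
  lebesgue (box a b) <= (box_vol a b)%:E.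
Proof.
move=> ab; apply: ereal_inf_lbound.
(* The covering is completed by degenerate boxes, of volume 0 since [0 < k]. *)
exists (fun i => if i == 0%N then a else 0%R), (fun i => if i == 0%N then b else 0%R).
split => [[|i] j //||]; first by move=> x xab; exists 0%N.
rewrite nneseries_recl //; last by case=> [|i] _; rewrite lee_fin box_vol_ge0.
rewrite eseries0 ?adde0 // => -[|i] // _ _.
by rewrite (bigD1 (Ordinal k_gt0)) //= mxE subrr mul0r.
Qed.

Lemma lebesgue_set0 : lebesgue (set0 : set 'rV[R]_k) = 0.
Proof.
apply/eqP; rewrite eq_le lebesgue_ge0 andbT.
have -> : 0 = (box_vol 0 0)%:E :> \bar R.
  by congr EFin; rewrite /box_vol (bigD1 (Ordinal k_gt0)) //= mxE subrr mul0r.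
by apply: le_trans (lebesgue_box _) => //; exact: le_lebesgue.
Qed.

Lemma lebesgue_bigcup_lt (N : nat) (A : nat -> set 'rV[R]_k) (c : R) :
  (forall i, (i < N)%N -> lebesgue (A i) <= c%:E) ->
  lebesgue (\bigcup_(i in [set i | (i < N)%N]) A i) <= (N%:R * c)%:E.
Proof.
move=> Ac; rewrite bigcup_mkcond; apply: le_trans (lebesgue_bigcup _) _.
rewrite (nneseries_split _ N); last by move=> i _; exact: lebesgue_ge0.
rewrite [X in _ + X]eseries0 ?adde0 => [|i Ni _]; last first.
  by rewrite memNset ?lebesgue_set0 //=; apply/negP; rewrite -leqNgt.
rewrite big_mkord mulr_natl -[X in (c *+ X)%R]card_ord -sumr_const -sumEFin.
by apply: lee_sum => i _; rewrite mem_set /= ?Ac.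
Qed.

End LebesgueOuterMeasure.

(** * Linear changes of variables *)

Section LinearChangeOfVariables.
Variables (R : realType) (k : nat).
Hypothesis k_gt0 : (0 < k)%N.
Implicit Types (a b x : 'rV[R]_k) (X : set 'rV[R]_k).

Definition scales_lebesgue (f : 'rV[R]_k -> 'rV[R]_k) (d : R) :=
  0 < d /\ forall X, lebesgue (f @` X) = (d%:E * lebesgue X)%E.

Lemma scales_lebesgue_comp f g d e :
  scales_lebesgue f d -> scales_lebesgue g e -> scales_lebesgue (f \o g) (d * e).
Proof.
move=> [d0 fd] [e0 ge]; split => [|X]; first exact: mulr_gt0.
by rewrite -image_comp fd ge muleA.
Qed.

Lemma eq_scales_lebesgue f g d : f =1 g -> scales_lebesgue f d -> scales_lebesgue g d.
Proof. by move=> fg; have -> : g = f by apply/funext => x; rewrite fg. Qed.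

(** The lower bound for [f] is the upper bound for its inverse [g]. *)
Lemma scales_lebesgue_inverse f g d e : 0 < d -> d * e = 1 -> cancel f g ->
  (forall a b, (forall j, a ord0 j <= b ord0 j) ->
     (lebesgue (f @` box a b) <= (d * box_vol a b)%:E)%E) ->
  (forall a b, (forall j, a ord0 j <= b ord0 j) ->
     (lebesgue (g @` box a b) <= (e * box_vol a b)%:E)%E) ->
  scales_lebesgue f d.
Proof.
move=> d0 de fK fbox gbox; split => // X.
have e0 : 0 < e by rewrite -(pmulr_rgt0 _ d0) de.
apply/eqP; rewrite eq_le lebesgue_image_le //= -lee_pdivlMl //.
have -> : d^-1 = e by rewrite -[RHS](mulKf (lt0r_neq0 d0)) de mulr1.
apply: le_trans (lebesgue_image_le e0 gbox _).
by apply: le_lebesgue => x Xx; exists (f x); rewrite ?fK //; exists x.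
Qed.

Lemma translation_scales_lebesgue c : scales_lebesgue (fun x => c + x) 1.
Proof.
have le c' a b : (forall j, a ord0 j <= b ord0 j) ->
    (lebesgue [set (c' + x)%R | x in box a b] <= (1 * box_vol a b)%:E)%E.
  move=> ab; have cab j : (c' + a) ord0 j <= (c' + b) ord0 j.
    by rewrite !mxE lerD2l.
  apply: (@le_trans _ _ (lebesgue (box (c' + a) (c' + b)))).
    by apply: le_lebesgue => _ [x xab <-] j; rewrite !mxE !lerD2l.
  apply: le_trans (lebesgue_box k_gt0 cab) _; rewrite mul1r lee_fin le_eqVlt.
  by apply/orP; left; apply/eqP/eq_bigr => j _; rewrite !mxE; ring.
apply: (@scales_lebesgue_inverse _ (fun x => - c + x) _ 1) => //; rewrite ?mulr1 //.
- by move=> x; rewrite addKr.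
- exact: le.
- exact: le.
Qed.

Definition set_coord (m : 'I_k) (r : R) x : 'rV[R]_k :=
  \row_j if j == m then r else x ord0 j.

Lemma set_coordE m r x j : set_coord m r x ord0 j = if j == m then r else x ord0 j.
Proof. by rewrite mxE. Qed.

Lemma box_vol_set_coord m r r' a b :
  box_vol (set_coord m r a) (set_coord m r' b) =
  (r' - r) * \prod_(j < k | j != m) (b ord0 j - a ord0 j).
Proof.
rewrite /box_vol (bigD1 m) //= !mxE eqxx; congr (_ * _).
by apply: eq_bigr => j /negbTE jm; rewrite !mxE jm.
Qed.

Lemma dilation_scales_lebesgue (m : 'I_k) s : s != 0 ->
  scales_lebesgue (fun x => set_coord m (s * x ord0 m) x) `|s|.
Proof.
have le t a b : t != 0 -> (forall j, a ord0 j <= b ord0 j) ->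
  (lebesgue [set set_coord m (t * x ord0 m)%R x | x in box a b]
     <= (`|t| * box_vol a b)%:E)%E.
  move=> t0 ab.
  pose lo := Num.min (t * a ord0 m) (t * b ord0 m).
  pose hi := Num.max (t * a ord0 m) (t * b ord0 m).
  have lohi : hi - lo = `|t| * (b ord0 m - a ord0 m).
    rewrite /hi /lo; have /ler_wpM2l := ab m; case: (ltrgtP t 0) t0 => // t0 _.
      rewrite ltr0_norm // => /(_ (- t)); rewrite oppr_ge0 ltW // => /(_ isT).
      rewrite !mulNr lerN2 => h; rewrite (max_l h) (min_r h); ring.
    rewrite gtr0_norm // => /(_ t (ltW t0)) h.
    by rewrite (max_r h) (min_l h) mulrBr.
  have ab' j : set_coord m lo a ord0 j <= set_coord m hi b ord0 j.
    rewrite !mxE; case: eqP => // _; rewrite -subr_ge0 lohi.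
    by rewrite mulr_ge0 ?subr_ge0.
  apply: (@le_trans _ _ (lebesgue (box (set_coord m lo a) (set_coord m hi b)))).
    apply: le_lebesgue => _ [x xab <-] j; rewrite !mxE; case: eqP => _; last exact: xab.
    have /andP[ax xb] := xab m; rewrite /lo /hi ge_min le_max.
    case: (ltrgtP t 0) t0 => // t0 _.
      by rewrite !(ler_nM2l t0) ax xb !orbT.
    by rewrite !(ler_pM2l t0) ax xb !orbT.
  apply: le_trans (lebesgue_box k_gt0 ab') _.
  by rewrite box_vol_set_coord lohi -mulrA lee_fin [box_vol a b](bigD1 m).
move=> s0; apply: (@scales_lebesgue_inverse _
    (fun x => set_coord m (s^-1 * x ord0 m) x) _ `|s^-1|).
- by rewrite normr_gt0.
- by rewrite -normrM divff // normr1.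
- move=> x; apply/rowP => j; rewrite !mxE eqxx; case: eqP => // ->.
  by rewrite mulKf.
- by move=> a b; apply: le.
- by move=> a b; apply: le; rewrite invr_eq0.
Qed.

Lemma mem_slice (N : nat) (u h t : R) : (0 < N)%N -> u <= t <= u + N%:R * h ->
  exists2 l, (l < N)%N & u + l%:R * h <= t <= u + l.+1%:R * h.
Proof.
elim: N => // N IH _ /andP[ut tN].
have [tN'|tN'] := leP t (u + N%:R * h); last by exists N; rewrite ?(ltW tN').
have [N0|N0] := posnP N.
  by exists 0%N; rewrite // mul0r addr0 ut -{1}N0.
have [|l lN tl] := IH N0; first by rewrite ut.
by exists l => //; apply: ltn_trans lN _.
Qed.

(** Cut the box into [N] slices along the coordinate [i]; the image of
    each slice fits into a box that is too long by [O(1/N)] in the direction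
    [m]. *)
Lemma shear_box_le (i m : 'I_k) s a b : i != m -> (forall j, a ord0 j <= b ord0 j) ->
  (lebesgue [set set_coord m (x ord0 m + s * x ord0 i)%R x | x in box a b]
     <= (1 * box_vol a b)%:E)%E.
Proof.
move=> im ab.
pose wi := b ord0 i - a ord0 i; pose wm := b ord0 m - a ord0 m.
pose P := \prod_(j < k | (j != m) && (j != i)) (b ord0 j - a ord0 j).
have P0 : 0 <= P by apply: prodr_ge0 => j _; rewrite subr_ge0.
have wi0 : 0 <= wi by rewrite subr_ge0.
have wm0 : 0 <= wm by rewrite subr_ge0.
have volE : box_vol a b = wm * (wi * P) by rewrite /box_vol (bigD1 m) //= (bigD1 i).
pose C := wi * P * (2 * (`|s| * wi)).
have C0 : 0 <= C by rewrite !mulr_ge0.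
apply/lee_addgt0Pr => e e0; rewrite mul1r volE -EFinD.
pose N := (Num.truncn (C / e)).+1.
have NR : (0 : R) < N%:R by rewrite ltr0n.
have CN : C / N%:R <= e.
  by rewrite ler_pdivrMr // mulrC -ler_pdivrMr // ltW // truncnS_gt.
pose h := wi / N%:R.
have h0 : 0 <= h by rewrite divr_ge0 // ltW.
pose lo l := set_coord m (a ord0 m + s * (a ord0 i + l%:R * h) - `|s| * h)
  (set_coord i (a ord0 i + l%:R * h) a).
pose hi l := set_coord m (b ord0 m + s * (a ord0 i + l%:R * h) + `|s| * h)
  (set_coord i (a ord0 i + l.+1%:R * h) b).
have sh : 0 <= `|s| * h by rewrite mulr_ge0.
have vlE l : box_vol (lo l) (hi l) = (wm + 2 * (`|s| * h)) * (h * P).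
  rewrite box_vol_set_coord (bigD1 i) //= !mxE eqxx -natr1 -/h; congr (_ * (_ * _)).
  - by rewrite /wm; ring.
  - by ring.
  - by apply: eq_bigr => j /andP[jm ji]; rewrite !mxE (negbTE ji).
have lohi l j : lo l ord0 j <= hi l ord0 j.
  rewrite !mxE; case: eqP => _; last case: eqP => _ //; last first.
    by rewrite -natr1; lra.
  by rewrite /wm in wm0; lra.
have leN := @lebesgue_bigcup_lt R k k_gt0 N (fun l => box (lo l) (hi l))
   (box_vol (lo 0%N) (hi 0%N)).
apply: le_trans (_ : (_ <= (N%:R * box_vol (lo 0%N) (hi 0%N))%:E)%E) _; last first.
  rewrite lee_fin vlE; apply: le_trans (_ : wm * (wi * P) + C / N%:R <= _); last by rewrite lerD2l.
  rewrite le_eqVlt; apply/orP; left; apply/eqP; rewrite /C /h; field.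
  by rewrite gt_eqF.
apply: le_trans (leN _) => [|l _]; last first.
  by apply: le_trans (lebesgue_box k_gt0 (lohi l)) _; rewrite !vlE.
apply: le_lebesgue => _ [x xab <-].
have [|l lN /andP[l1 l2]] := @mem_slice N (a ord0 i) h (x ord0 i) isT.
  have /andP[-> xb] := xab i.
  by rewrite /h mulrC divfK ?gt_eqF // /wi addrC subrK xb.
exists l => //; have hh : `|s * (x ord0 i - (a ord0 i + l%:R * h))| <= `|s| * h.
  move: l2; rewrite -natr1 mulrDl mul1r => l2.
  rewrite normrM ler_wpM2l // ger0_norm ?subr_ge0 //; lra.
move=> j; rewrite !mxE; case: eqP => [_|/eqP jm]; last case: eqP => [->|_]; last exact: xab.
  by move: hh (xab m); rewrite ler_norml => /andP[h1 h2] /andP[h3 h4]; lra.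
by rewrite l1.
Qed.

Lemma shear_scales_lebesgue (i m : 'I_k) s : i != m ->
  scales_lebesgue (fun x => set_coord m (x ord0 m + s * x ord0 i) x) 1.
Proof.
move=> im; apply: (@scales_lebesgue_inverse _
  (fun x => set_coord m (x ord0 m + - s * x ord0 i) x) _ 1) => //; rewrite ?mulr1 //.
- move=> x; apply/rowP => j; rewrite !mxE eqxx (negbTE im).
  by case: eqP => // ->; ring.
- by move=> a b; apply: shear_box_le.
- by move=> a b; apply: shear_box_le.
Qed.

Lemma shears_scale_lebesgue (s : seq 'I_k) (m : 'I_k) (c : 'I_k -> R) : m \notin s ->
  scales_lebesgue
    (fun x => set_coord m (x ord0 m + \sum_(i <- s) c i * x ord0 i) x) 1.
Proof.
elim: s => [_|i s IH]; rewrite ?inE ?negb_or.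
  have := @dilation_scales_lebesgue m 1 (oner_neq0 _); rewrite normr1.
  by apply: eq_scales_lebesgue => x; rewrite big_nil addr0 mul1r.
move=> /andP[mi ms]; rewrite -[1]mulr1.
apply: eq_scales_lebesgue (scales_lebesgue_comp (IH ms) (@shear_scales_lebesgue i m (c i) _)).
  move=> x /=; apply/rowP => j; rewrite !mxE eqxx; case: (j == m) => //.
  rewrite big_cons addrA; congr (_ + _); apply: eq_big_seq => l ls.
  by rewrite mxE; case: eqP ms => // <-; rewrite ls.
by rewrite eq_sym.
Qed.

(** Upper triangular matrices act by rewriting the coordinates one at a time,
    from the last to the first, each as a combination of coordinates that have
    not been rewritten yet. *)
Lemma triangular_scales_lebesgue (U : 'M[R]_k) :
  (forall i j : 'I_k, (j < i)%N -> U i j = 0) -> (forall i, U i i != 0) ->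
  scales_lebesgue (fun x => x *m U) `|\det U|.
Proof.
move=> Utri Ud.
pose T p x : 'rV[R]_k := \row_j if (p <= j)%N then (x *m U) ord0 j else x ord0 j.
suff H p : (p <= k)%N -> scales_lebesgue (T (k - p)%N) (\prod_(j < k | (k - p <= j)%N) `|U j j|).
  have := H k (leqnn k); rewrite subnn det_upper_tri // normr_prod.
  by apply: eq_scales_lebesgue => x; apply/rowP => j; rewrite !mxE.
elim: p => [_|p IH pk].
  rewrite subn0 big1 => [|j]; last by rewrite leqNgt ltn_ord.
  have := translation_scales_lebesgue 0.
  by apply: eq_scales_lebesgue => x; apply/rowP => j; rewrite !mxE add0r leqNgt ltn_ord.
have mk : (k - p.+1 < k)%N by lia.
pose m := Ordinal mk.
rewrite (bigD1 m) //= (eq_bigl (fun j : 'I_k => (k - p <= j)%N)); last first.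
  by move=> j; rewrite -val_eqE /=; lia.
rewrite -[`|U m m|]mul1r.
apply: eq_scales_lebesgue (scales_lebesgue_comp (scales_lebesgue_comp
  (@shears_scale_lebesgue (enum [pred i : 'I_k | (i < m)%N]) m (fun i => U i m) _)
  (@dilation_scales_lebesgue m _ (Ud m))) (IH (ltnW pk))); last first.
  by rewrite mem_enum inE ltnn.
move=> x; apply/rowP => j; rewrite /= !mxE eqxx.
have [->|jm] := eqVneq j m; last first.
  have -> : (k - p.+1 <= j)%N = (k - p <= j)%N.
    by move: jm; rewrite -val_eqE /=; lia.
  by [].
have -> : (k - p <= m)%N = false by rewrite /=; lia.
rewrite leqnn big_enum /= [RHS](bigD1 m) //= [U m m * _]mulrC; congr (_ + _).
rewrite [RHS](bigID (fun i : 'I_k => (i < m)%N)) /= [X in _ = _ + X]big1 ?addr0; last first.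
  by move=> i /andP[im im']; rewrite Utri ?mulr0 //; move: im im'; rewrite -val_eqE /=; lia.
apply: eq_big => [i|i im]; first by rewrite -val_eqE inE /=; lia.
rewrite !mxE mulrC; case: eqP => [E|_]; first by move: im; rewrite E inE ltnn.
by have -> : (k - p <= i)%N = false by move: im; rewrite inE /=; lia.
Qed.

Lemma ball_orthogonal (Q : 'M[R]_k) : Q *m Q^T = 1%:M ->
  [set x *m Q | x in unit_ball R k] = unit_ball R k.
Proof.
move=> QQ; apply/seteqP; split => [_ [x + <-]|x]; rewrite /= !unit_ballE.
  by rewrite dot_orthonormal.
move=> x1; exists (x *m Q^T); last by rewrite -mulmxA (mulmx1C QQ) mulmx1.
by rewrite unit_ballE dot_orthonormal // trmxK (mulmx1C QQ).
Qed.

(** Writing [T = Q U], the orthogonal factor fixes the ball. *)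
Lemma lebesgue_ellipsoid c (T : 'M[R]_k) : T \in unitmx ->
  lebesgue [set c + x *m T | x in unit_ball R k] =
  (`|\det T|%:E * lebesgue (unit_ball R k))%E.
Proof.
have [Q [U [-> QQ Utri]]] := QR_decomposition T.
rewrite unitmxE det_mulmx unitfE mulf_eq0 negb_or => /andP[_ U0].
rewrite normrM; have -> : `|\det Q| = 1.
  by apply/eqP; rewrite -sqr_norm_eq1 sqr_det_orthogonal.
have [|_ UE] := triangular_scales_lebesgue Utri.
  by move=> i; move: U0; rewrite det_upper_tri // => /prodf_neq0 ->.
have [_ cE] := translation_scales_lebesgue c.
rewrite mul1r -UE -[RHS]mul1e -cE; congr lebesgue.
apply/seteqP; split => [_ [x x1 <-]|_ [_ [x x1 <-] <-]].
  exists (x *m Q *m U); rewrite -?mulmxA //; exists (x *m Q); rewrite -?mulmxA //.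
  by rewrite -(ball_orthogonal QQ); exists x.
by move: x1; rewrite -{1}(ball_orthogonal QQ) => -[y y1 <-]; exists y; rewrite // mulmxA.
Qed.

End LinearChangeOfVariables.

(** * Volume of the ball *)

Section BallVolume.
Variables (R : realType) (k : nat).
Hypothesis k_gt0 : (0 < k)%N.
Implicit Types (a b x : 'rV[R]_k).
Local Open Scope ereal_scope.

(** Integrating the inequality [1 <= \sum_i (indicator of the i-th box)] over
    the unit cube, one coordinate after the other, bounds the total volume of a
    covering; after [m] steps the first [m] coordinates have been integrated. *)
Lemma cover_cube_integrated (a b : nat -> 'rV[R]_k) (m : nat) :
  (forall i j, a i ord0 j <= b i ord0 j)%R ->
  box 0%R (const_mx 1%R) `<=` \bigcup_i box (a i) (b i) -> (m <= k)%N ->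
  forall x, box 0%R (const_mx 1%R) x ->
  1 <= \sum_(i <oo) (\prod_(j < k) if (j < m)%N then b i ord0 j - a i ord0 j
     else (\1_(`[a i ord0 j, b i ord0 j]%classic : set R) (x ord0 j)))%:E.
Proof.
move=> ab cov.
have term_ge0 n i (x : 'rV[R]_k) (P : pred 'I_k) :
  (0 <= \prod_(j < k | P j) if (j < n)%N then b i ord0 j - a i ord0 j
     else (\1_(`[a i ord0 j, b i ord0 j]%classic : set R) (x ord0 j)))%R.
  by apply: prodr_ge0 => j _; case: ifP; rewrite ?subr_ge0 // indicE.
elim: m => [_ x /cov [i _ xi]|m IH mk x x01].
  apply: le_trans (nneseries_lim_ge i.+1 _) => [|n _ _]; last first.
    by rewrite lee_fin (term_ge0 0%N n x xpredT).
  rewrite big_mkord big_ord_recr /= -[1]add0e leeD //.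
    by apply: sume_ge0 => n _; rewrite lee_fin (term_ge0 0%N n x xpredT).
  rewrite lee_fin big1 // => j _; rewrite indicE mem_set //= in_itv /=.
  exact: xi.
pose m' := Ordinal mk.
pose c i : R := (\prod_(j < k | j != m') if (j < m)%N then b i ord0 j - a i ord0 j
     else (\1_(`[a i ord0 j, b i ord0 j]%classic : set R) (x ord0 j)))%R.
have c0 i : (0 <= c i)%R by exact: term_ge0.
pose I i : set R := `[a i ord0 m', b i ord0 m']%classic.
pose D : set R := `[0%R, 1%R]%classic.
have mD : measurable D by exact: measurable_itv.
have mI i : measurable (I i) by exact: measurable_itv.
have F t : D t -> 1 <= \sum_(i <oo) (c i * \1_(I i) t)%:E.
  rewrite /D /= in_itv /= => Dt.
  have /(IH (ltnW mk)) : box 0%R (const_mx 1%R) (set_coord m' t x).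
    by move=> j; have := x01 j; rewrite !mxE; case: eqP.
  congr (_ <= _); apply: eq_eseriesr => i _; congr EFin.
  rewrite (bigD1 m') //= ltnn set_coordE eqxx mulrC; congr (_ * _)%R.
  by apply: eq_bigr => j /negbTE jm; rewrite set_coordE jm.
have int1 : \int[lebesgue_measure]_(t in D) (cst 1 t) = 1.
  rewrite integral_cst // mul1e [LHS](lebesgue_measure_itv `[0%R, 1%R]) /= lte_fin ltr01.
  by rewrite oppr0 adde0.
rewrite -[X in X <= _]int1.
have meas1 i : measurable_fun D (fun t : R => \1_(I i) t : R).
  by apply: measurable_indic.
have meas i : measurable_fun D (EFin \o (fun t : R => c i * \1_(I i) t)%R).
  by apply/measurable_EFinP; apply: measurable_funM.
apply: (@le_trans _ _ (\int[lebesgue_measure]_(t in D) \sum_(i <oo) (c i * \1_(I i) t)%:E)).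
  apply: ge0_le_integral => //.
  apply: (@ge0_emeasurable_sum _ _ _ D (fun i t => (c i * \1_(I i) t)%:E) xpredT) => [i t _ _|i _].
    by rewrite lee_fin mulr_ge0.
  exact: meas.
rewrite integral_nneseries //; last first.
  by move=> i t _; rewrite lee_fin mulr_ge0.
apply: lee_nneseries => [i _ _|i _].
  by apply: integral_ge0 => t _; rewrite lee_fin mulr_ge0.
under eq_integral do rewrite EFinM.
rewrite ge0_integralZl_EFin //; last by have /measurable_EFinP := meas1 i.
rewrite integral_indic //; last exact: mI.
rewrite (bigD1 m') //= ltnSn mulrC EFinM.
rewrite (_ : \prod_(j < k | j != m') _ = c i)%R; last first.
  apply: eq_bigr => j jm; rewrite ltnS leq_eqVlt.
  by have /negbTE -> : (j != m :> nat) by move: jm; rewrite -val_eqE.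
rewrite lee_wpmul2l ?lee_fin //.
apply: (@le_trans _ _ (lebesgue_measure (I i))).
  apply: le_measure; rewrite ?inE /=; [|exact: mI|exact: subIsetl].
  exact: measurableI (mI i) mD.
rewrite [X in X <= _](lebesgue_measure_itv `[a i ord0 m', b i ord0 m']) /=.
by case: ifP => //; rewrite lee_fin subr_ge0.
Qed.

Lemma lebesgue_cube_ge1 : 1 <= lebesgue (box 0%R (const_mx 1%R) : set 'rV[R]_k).
Proof.
apply: le_ereal_inf_tmp => _ [a [b [ab cov ->]]].
have := cover_cube_integrated ab cov (leqnn k).
have c0 : box 0%R (const_mx 1%R) (0%R : 'rV[R]_k) by move=> j; rewrite !mxE lexx ler01.
move=> /(_ _ c0) /le_trans; apply; rewrite le_eqVlt; apply/orP; left; apply/eqP.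
by apply: eq_eseriesr => i _; congr EFin; apply: eq_bigr => j _; rewrite ltn_ord.
Qed.

Lemma lebesgue_ball_gt0 : 0 < lebesgue (unit_ball R k).
Proof.
have kR : (0 < k%:R :> R)%R by rewrite ltr0n.
pose r : R := (k%:R^-1)%R; have r0 : (0 < r)%R by rewrite invr_gt0.
have [|i|d0 rE] := @triangular_scales_lebesgue R k k_gt0 (r%:M)%R.
- by move=> i j ij; rewrite mxE -val_eqE gtn_eqF.
- by rewrite mxE eqxx lt0r_neq0.
apply: lt_le_trans (_ : 0 < (`|\det (r%:M : 'M[R]_k)|%R)%:E * lebesgue (box 0%R (const_mx 1%R))) _.
  rewrite mule_gt0 ?lte_fin //; apply: lt_le_trans lebesgue_cube_ge1.
  by rewrite lte_fin.
rewrite -rE.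
apply: le_lebesgue => _ [x x01 <-]; rewrite unit_ballE mul_mx_scalar dotZl dotZr.
have xk : (dot x x <= k%:R)%R.
  rewrite -[X in X%:R]card_ord -sumr_const ler_sum // => j _.
  have := x01 j; rewrite !mxE => /andP[x0 x1]; by rewrite -[leRHS]mulr1 ler_pM.
have k1 : (1 <= k%:R :> R)%R by rewrite ler1n.
apply: le_trans (ler_wpM2l (ltW r0) (ler_wpM2l (ltW r0) xk)) _.
by rewrite /r mulVf ?mulr1 ?invf_le1 // gt_eqF.
Qed.

Lemma lebesgue_ball_lty : lebesgue (unit_ball R k) < +oo.
Proof.
apply: (@le_lt_trans _ _ (lebesgue (box (const_mx (-1)%R) (const_mx 1%R : 'rV[R]_k)))).
  apply: le_lebesgue => x x1 j; rewrite !mxE -ler_norml.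
  exact: le_trans (le_coord_enorm x j) x1.
apply: le_lt_trans (lebesgue_box k_gt0 _) (ltry _) => j.
by rewrite !mxE; lra.
Qed.

Lemma lebesgue_ball_fin : lebesgue (unit_ball R k) \is a fin_num.
Proof. by rewrite ge0_fin_numE ?lebesgue_ge0 // lebesgue_ball_lty. Qed.

Lemma lebesgue_ball_scale_le (r s : R) :
  (r%:E * lebesgue (unit_ball R k) <= s%:E * lebesgue (unit_ball R k)) = (r <= s)%R.
Proof. by rewrite lee_pmul2r ?lebesgue_ball_gt0 ?lebesgue_ball_fin ?lee_fin. Qed.

Lemma lebesgue_ball_scale_inj (r s : R) :
  r%:E * lebesgue (unit_ball R k) = s%:E * lebesgue (unit_ball R k) -> r = s.
Proof.
by move=> rs; apply/eqP; rewrite eq_le -!lebesgue_ball_scale_le rs lexx.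
Qed.

End BallVolume.

(** * Volume of ellipsoids *)

Section EllipsoidVolume.
Variable R : realType.

Definition ellipsoid k n (c : 'rV[R]_n) (M : 'M[R]_(k, n)) : set 'rV[R]_n :=
  [set c + y *m M | y in unit_ball R k].

Lemma is_ellipsoidP k n (E : set 'rV[R]_n) :
  is_ellipsoid k E <-> exists c (M : 'M[R]_(k, n)), row_free M /\ E = ellipsoid c M.
Proof.
split=> [[f [c [finj ->]]]|[c [M [Mfree ->]]]].
  exists c, (lin1_mx f); split.
    apply/inj_row_free => v; rewrite mul_rV_lin1 => fv0.
    by apply: finj; rewrite fv0 linear0.
  by apply/seteqP; split => _ [y y1 <-]; exists y; rewrite // mul_rV_lin1.
exists (mulmxr M : {linear _ -> _}), c; split=> // u v /=.
exact: row_free_inj.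
Qed.

Lemma unit_ball0 n : unit_ball R n 0.
Proof. by rewrite unit_ballE dot0l ler01. Qed.

Lemma unit_ball_delta n i : unit_ball R n (delta_mx 0 i).
Proof.
rewrite unit_ballE /dot (bigD1 i) //= big1 => [|j ji].
  by rewrite !mxE !eqxx mulr1 addr0.
by rewrite !mxE (negbTE ji) andbF mul0r.
Qed.

(** In orthonormal coordinates of its flat an ellipsoid is the image of the
    ball under a square matrix [T] with [T T^T = M M^T], whatever the
    coordinates. *)
Lemma vol_ellipsoid k n c (M : 'M[R]_(k, n)) : (0 < k)%N -> row_free M ->
  vol k (ellipsoid c M) =
  ((Num.sqrt (\det (M *m M^T)))%:E * lebesgue (unit_ball R k))%E.
Proof.
move=> k0 Mfree; set V := RHS.
suff -> : vol k (ellipsoid c M) = ereal_inf [set V] by rewrite ereal_inf1.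
congr ereal_inf; apply/seteqP; split => [v [A [c' [AA sub ->]]]|v ->]; last first.
  have [A [AA /andP[_ /submxP[D MD]]]] := row_space_orthonormal (eqP Mfree).
  exists A, c; split => //.
    by move=> _ [y _ <-]; exists (y *m D) => //; rewrite MD mulmxA.
  have unitD : D \in unitmx.
    rewrite -row_free_unit -kermx_eq0 -submx0; apply/rV_subP => x /sub_kermxP xD.
    rewrite submx0 -(mulmx_free_eq0 _ Mfree) MD mulmxA xD mul0mx //.
  rewrite (_ : [set u | _] = [set (0 + y *m D) | y in unit_ball R k]); last first.
    apply/seteqP; split => [u [y y1 /addrI E]|_ [y y1 <-]] /=.
      exists y => //; rewrite add0r -[LHS]mulmx1 -AA !mulmxA -[_ *m D *m A]mulmxA -MD E.
      by rewrite -mulmxA AA mulmx1.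
    by exists y; rewrite // MD mulmxA add0r.
  rewrite lebesgue_ellipsoid // /V MD trmx_mul mulmxA -[D *m A *m _]mulmxA AA mulmx1.
  by rewrite det_mulmx det_tr -expr2 sqrtr_sqr.
have [u0 _ c'E] : range (fun u : 'rV_k => c' + u *m A) c.
  by apply: sub; exists 0; rewrite ?mul0mx ?addr0 //; exact: unit_ball0.
pose T := M *m A^T.
have MT : M = T *m A.
  apply/row_matrixP => i.
  have [u _] : range (fun u : 'rV_k => c' + u *m A) (c + row i M).
    by apply: sub; exists (delta_mx 0 i); rewrite -?rowE //; exact: unit_ball_delta.
  rewrite -c'E -addrA => /addrI /eqP; rewrite -subr_eq0 opprD addrA -mulmxBl subr_eq0.
  by move/eqP=> E; rewrite /T !row_mul -E -[_ *m A *m A^T]mulmxA AA mulmx1.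
have unitT : T \in unitmx.
  rewrite -row_free_unit -kermx_eq0 -submx0; apply/rV_subP => x /sub_kermxP xT.
  by rewrite submx0 -(mulmx_free_eq0 _ Mfree) MT mulmxA xT mul0mx.
rewrite /= (_ : [set u | _] = [set u0 + y *m T | y in unit_ball R k]); last first.
  apply/seteqP; split => [u [y y1]|_ [y y1 <-]] /=.
    rewrite -c'E -addrA => /addrI E; exists y => //.
    have := congr1 (mulmx^~ A^T) E.
    by rewrite MT !mulmxDl -!mulmxA AA !mulmx1.
  by exists y; rewrite // -c'E mulmxDl -mulmxA -MT addrA.
rewrite lebesgue_ellipsoid // /V MT trmx_mul mulmxA -[T *m A *m _]mulmxA AA mulmx1.
by rewrite det_mulmx det_tr -expr2 sqrtr_sqr.
Qed.

Lemma lebesgue_dilate k r : (0 < k)%N -> 0 < r ->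
  lebesgue (dilate r (unit_ball R k)) = ((r ^+ k)%:E * lebesgue (unit_ball R k))%E.
Proof.
move=> k0 r0; rewrite -[r ^+ k]ger0_norm ?exprn_ge0 ?ltW // -det_scalar.
rewrite -(lebesgue_ellipsoid k0 0); last first.
  by rewrite unitmxE det_scalar unitfE expf_neq0 // gt_eqF.
by congr lebesgue; apply/seteqP; split => _ [y y1 <-]; exists y; rewrite // mul_mx_scalar add0r.
Qed.

End EllipsoidVolume.

(** * Subspaces and orthogonal projections in coordinates *)

Section Subspaces.
Variable R : realType.

(** The condition on [v] says that [v] is fixed by the orthogonal projection
    [A^T A], i.e., lies in the row space of [A]. *)
Lemma subspace_orthonormal n k (F : {vspace 'rV[R]_n}) : \dim F = k ->
  exists A : 'M[R]_(k, n), A *m A^T = 1%:M /\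
    forall v, v \in F <-> v *m A^T *m A = v.
Proof.
move=> Fk; pose U := \matrix_(i < \dim F) ((vbasis F)`_i : 'rV[R]_n).
have mulU (u : 'rV_(\dim F)) : u *m U = \sum_i u 0 i *: (vbasis F)`_i.
  by rewrite mulmx_sum_row; apply: eq_bigr => i _; rewrite rowK.
have FU v : v \in F <-> (v <= U)%MS.
  split=> [vF|/submxP[u ->]].
    apply/submxP; exists (\row_i coord (vbasis F) i v).
    rewrite mulU [LHS](coord_vbasis vF); apply: eq_bigr => i _.
    by rewrite mxE.
  rewrite mulU; apply: memv_suml => i _; apply: memvZ.
  by apply: vbasis_mem; apply: mem_nth; rewrite size_tuple.
have rU : \rank U = k.
  rewrite -Fk; apply/eqP/inj_row_free => u; rewrite mulU => u0.
  have /freeP /(_ _ u0) ui := basis_free (vbasisP F).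
  by apply/rowP => i; rewrite ui mxE.
have [A [AA AU]] := row_space_orthonormal rU; exists A; split => // v.
rewrite FU -(eqmxP AU); split=> [/submxP[D ->]|<-]; last exact: submxMl.
by rewrite -[D *m A *m _]mulmxA AA mulmx1.
Qed.

Lemma row_subspace n k (A : 'M[R]_(k, n)) : A *m A^T = 1%:M ->
  exists F : {vspace 'rV[R]_n}, \dim F = k /\
    forall v, v \in F <-> v *m A^T *m A = v.
Proof.
move=> AA; exists (limg (linfun (mulmxr A : 'rV_k -> 'rV_n))); split.
  rewrite limg_dim_eq ?dimvf /= ?dim_matrix ?mul1r ?mul1n //.
  apply/eqP; rewrite -subv0; apply/subvP => u.
  rewrite capfv memv_ker lfunE /= memv0 => /eqP uA.
  by rewrite -[u]mulmx1 -AA mulmxA uA mul0mx.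
move=> v; split=> [/memv_imgP[u _ ->]|<-].
  by rewrite lfunE /= -[u *m A *m _]mulmxA AA mulmx1.
apply/memv_imgP; exists (v *m A^T); rewrite ?memvf //.
by rewrite lfunE.
Qed.

Lemma orth_projE n k (A : 'M[R]_(k, n)) (F : {vspace 'rV[R]_n}) (X : set 'rV[R]_n) :
  A *m A^T = 1%:M -> (forall v, v \in F <-> v *m A^T *m A = v) ->
  orth_proj F X = [set x *m A^T *m A | x in X].
Proof.
move=> AA FA; apply/seteqP; split => [y [/FA yF [x Xx xy]]|_ [x Xx <-]].
  exists x => //; have wF : (x *m A^T *m A - y) \in F.
    by apply/FA; rewrite !mulmxBl yF -[_ *m A *m A^T]mulmxA AA mulmx1.
  have wE : x *m A^T *m A - y = (x - y) *m A^T *m A by rewrite !mulmxBl yF.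
  apply/eqP; rewrite -subr_eq0 -dot_eq0; apply/eqP.
  rewrite -(xy _ wF) wE [RHS]dotC !(dot_mull (_ *m A^T)).
  by rewrite -[_ *m A *m A^T]mulmxA AA mulmx1.
split; first by apply/FA; rewrite -[_ *m A *m A^T]mulmxA AA mulmx1.
exists x => // z /FA <-; rewrite dotC (dot_mull (_ *m A^T)) mulmxBl.
by rewrite -[_ *m A *m A^T]mulmxA AA mulmx1 subrr dotC dot0l.
Qed.

End Subspaces.

(** * First-order expansion of polynomials *)

Section FirstOrder.
Variable R : realType.

(** For small [e > 0] the sign of the linear coefficient decides. *)
Lemma poly_second_order (p : {poly R}) : exists2 D, 0 <= D &
  forall e, 0 <= e <= 1 -> p.[e] <= p`_0 + p`_1 * e + D * e ^+ 2.
Proof.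
pose D := \sum_(i < size p) `|p`_i.+2|; exists D; first by apply: sumr_ge0.
move=> e /andP[e0 e1].
have pE : p = \poly_(i < (size p).+2) p`_i.
  apply/polyP => i; rewrite coef_poly; case: ltnP => // si.
  by rewrite nth_default // (leq_trans _ si) // -addn2 leq_addr.
rewrite [p in p.[e]]pE horner_poly !big_ord_recl /= expr0 mulr1 expr1 addrA lerD2l.
rewrite /D mulr_suml; apply: ler_sum => i _; rewrite /bump /= !add1n.
apply: le_trans (ler_norm _) _; rewrite normrM ler_wpM2l // ger0_norm ?exprn_ge0 //.
by rewrite -addn2 exprD ler_piMl ?exprn_ge0 // exprn_ile1.
Qed.

Lemma coef0_prod I (r : seq I) (f : I -> {poly R}) : (forall i, (f i)`_0 = 1) ->
  (\prod_(i <- r) f i)`_0 = 1.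
Proof.
move=> f0; elim/big_rec: _ => [|i q _ q0]; first by rewrite coefC.
by rewrite coefM big_ord_recl big_ord0 subn0 f0 q0 addr0 mulr1.
Qed.

Lemma coef1_prod I (r : seq I) (f : I -> {poly R}) : (forall i, (f i)`_0 = 1) ->
  (\prod_(i <- r) f i)`_1 = \sum_(i <- r) (f i)`_1.
Proof.
move=> f0; elim: r => [|i r IH]; first by rewrite !big_nil coefC.
rewrite !big_cons coefM !big_ord_recl big_ord0 /= subn0 subnn addr0 f0 mul1r IH.
by rewrite coef0_prod // mulr1 addrC.
Qed.

End FirstOrder.

(** * The trace inequality of the Loewner position *)

Section JohnInequality.
Variable R : realType.

(** The inequality to which John's decomposition of the identity would lead,
    obtained without it. If it failed, the ellipsoid
    [|x (1 + e Y) - e w|^2 <= 1 - e |b|^2 + C e^2], where [Y] is the triangular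
    matrix with [Y + Y^T = G G^T - 1] and [w = b G^T], would contain [K] and,
    for small [e > 0], be smaller than the ball: the left side is, to first
    order in [e], [(1 - e) |x|^2 + e (|x G - b|^2 - |b|^2)]. The triangular
    shape of [Y] makes the determinant explicit. *)
Lemma loewner_trace_le n k (K : set 'rV[R]_n) (G : 'M[R]_(n, k)) (b : 'rV[R]_k) :
  (0 < n)%N -> is_loewner K (unit_ball R n) ->
  (forall x, K x -> dot (x *m G - b) (x *m G - b) <= 1) ->
  \tr (G^T *m G) + n%:R * dot b b <= n%:R.
Proof.
move=> n0 [_ Kball Kmin] KG; rewrite leNgt; apply/negP => big.
have [X XE] : exists X, X = G *m G^T - 1%:M by exists (G *m G^T - 1%:M).
pose Y := \matrix_(i, j) (if i == j then X i i / 2 else if (j < i)%N then X i j else 0).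
have Xsym : X^T = X by rewrite XE linearB /= trmx_mul trmxK trmx1.
have YX : Y + Y^T = X.
  apply/matrixP => i j; rewrite ![in LHS]mxE [j == i]eq_sym.
  have [<-|ij] := eqVneq i j; first by rewrite -splitr.
  have Xij : X i j = X j i by rewrite -{1}Xsym mxE.
  case: ltngtP => [||/val_inj E]; rewrite ?addr0 ?add0r //.
  by rewrite E eqxx in ij.
have trX : \tr X = \tr (G^T *m G) - n%:R.
  by rewrite XE linearB /= mxtrace1 mxtrace_mulC.
pose w := b *m G^T.
pose beta := dot b b; have beta0 : 0 <= beta := dot_ge0 b.
(* A bound on [|x Y - w| ^ 2] over the unit ball. *)
pose C := \sum_j (\sum_i `|Y i j| + `|w 0 j|) ^+ 2.
have C0 : 0 <= C by apply: sumr_ge0 => j _; rewrite sqr_ge0.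
have CP x : dot x x <= 1 -> dot (x *m Y - w) (x *m Y - w) <= C.
  move=> x1; apply: ler_sum => j _; rewrite -expr2 -[leLHS]real_normK ?num_real //.
  have xj i : `|x 0 i| <= 1.
    by apply: le_trans (le_coord_enorm x i) _; rewrite enorm_le // expr1n.
  rewrite ler_sqr ?nnegrE ?addr_ge0 ?sumr_ge0 //.
  rewrite !mxE; apply: le_trans (ler_normB _ _) _; rewrite lerD2r.
  apply: le_trans (ler_norm_sum _ _ _) _; apply: ler_sum => i _.
  by rewrite normrM ler_piMl.
have inside e x : 0 <= e -> e <= 1 -> K x ->
    dot (x *m (1%:M + e *: Y) - e *: w) (x *m (1%:M + e *: Y) - e *: w)
      <= 1 - e * beta + e ^+ 2 * C.
  move=> e0 e1 Kx; have x1 : dot x x <= 1 by rewrite -unit_ballE; exact: Kball.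
  have xX : dot (x *m Y) x *+ 2 = dot (x *m G) (x *m G) - dot x x.
    rewrite mulr2n {2}[dot (x *m Y) x]dot_mull [dot x _]dotC -dotDl -mulmxDr YX.
    by rewrite XE mulmxBr mulmx1 dotDl dotNl mulmxA [dot (_ *m G^T) x]dot_mull trmxK.
  have xw : dot x w = dot (x *m G) b by rewrite dot_mull.
  rewrite mulmxDr mulmx1 -scalemxAr -addrA -scalerBr.
  have -> d : dot (x + e *: d) (x + e *: d) = dot x x + e * dot x d *+ 2 + e ^+ 2 * dot d d.
    by rewrite dotDl !dotDr !(dotZl, dotZr) (dotC d x); ring.
  have zC : e ^+ 2 * dot (x *m Y - w) (x *m Y - w) <= e ^+ 2 * C.
    by rewrite ler_wpM2l ?exprn_ge0 ?CP.
  have := KG _ Kx; rewrite dotB -/beta => Gx.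
  have : e * (dot x x + dot x (x *m Y - w) *+ 2) <= e * (1 - beta).
    by apply: ler_wpM2l => //; rewrite dotDr dotNr xw mulrnBl [dot x (x *m Y)]dotC xX; lra.
  have : (1 - e) * dot x x <= (1 - e) * 1 by rewrite ler_wpM2l // subr_ge0.
  lra.
pose f (i : 'I_n) : {poly R} := 1 - beta *: 'X + C *: 'X^2.
pose g (i : 'I_n) : {poly R} := (1 + Y i i *: 'X) * (1 + Y i i *: 'X).
pose p : {poly R} := \prod_i f i - \prod_i g i.
pose s := \tr (G^T *m G) + n%:R * beta - n%:R.
have s0 : 0 < s by rewrite subr_gt0.
have f0 i : (f i)`_0 = 1.
  by rewrite !coefD coefN !coefZ coefX coefXn coefC /= !mulr0 subr0 addr0.
have f1 i : (f i)`_1 = - beta.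
  by rewrite !coefD coefN !coefZ coefX coefXn coefC /= mulr1 mulr0 addr0 add0r.
have g0 i : (g i)`_0 = 1.
  by rewrite coefM big_ord_recl big_ord0 subn0 !coefD !coefZ coefX coefC /= mulr0 !addr0 mulr1.
have g1 i : (g i)`_1 = X i i.
  by rewrite coefM !big_ord_recl big_ord0 /= !coefD !coefZ !coefX !coefC /= mxE eqxx; field.
have p0 : p`_0 = 0 by rewrite coefB !coef0_prod ?subrr.
have p1 : p`_1 = - s.
  rewrite coefB !coef1_prod //.
  have -> : \sum_i (f i)`_1 = - beta *+ n.
    rewrite (eq_bigr (fun=> - beta)) => [|j _]; last exact: f1.
    by rewrite sumr_const card_ord.
  have -> : \sum_i (g i)`_1 = \tr X by apply: eq_bigr => j _; exact: g1.
  by rewrite trX /s -mulr_natl; ring.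
have [D D0 pD] := poly_second_order p.
(* [L] is large enough for [e = 1 / L] to keep the new ellipsoid nondegenerate
   and the second order term [D e ^ 2] below the first order term [s e]. *)
pose L := 1 + beta + \sum_i `|Y i i| + D / s.
have sY : 0 <= \sum_i `|Y i i| by apply: sumr_ge0.
have Ds : 0 <= D / s by rewrite divr_ge0 // ltW.
have L1 : 1 <= L by rewrite /L; lra.
have L0 : 0 < L by lra.
pose e := L^-1; have e0 : 0 < e by rewrite invr_gt0.
have e1 : e <= 1 by rewrite invf_le1.
have small t : 0 <= t -> t < L -> e * t < 1.
  by move=> t0 tL; rewrite mulrC ltr_pdivrMr // mul1r.
have pe : p.[e] < 0.
  apply: le_lt_trans (pD e _) _; first by rewrite e1 ltW.
  have : e * (D / s) < 1 by apply: small => //; rewrite /L; lra.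
  rewrite mulrA ltr_pdivrMr // mul1r => De.
  have : e * (e * D) < e * s by rewrite ltr_pM2l.
  rewrite p0 p1; lra.
pose T := 1%:M + e *: Y.
pose rho2 := 1 - e * beta + e ^+ 2 * C.
have rho0 : 0 < rho2.
  have : e * beta < 1 by apply: small => //; rewrite /L; lra.
  have : 0 <= e ^+ 2 * C by rewrite mulr_ge0 ?exprn_ge0 // ltW.
  rewrite /rho2; lra.
have Tdiag i : T i i = 1 + e * Y i i by rewrite !mxE eqxx.
have T0 i : T i i != 0.
  rewrite Tdiag; have : e * `|Y i i| < 1.
    apply: small => //; apply: le_lt_trans (_ : \sum_i `|Y i i| < _).
      by rewrite (bigD1 i) //= lerDl sumr_ge0.
    rewrite /L; lra.
  have := ler_norm (- Y i i); rewrite normrN => h1 h2.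
  have : e * - Y i i < 1 by apply: le_lt_trans h2; rewrite ler_pM2l.
  by move=> h3; rewrite gt_eqF //; lra.
have detT : \det T = \prod_i T i i.
  apply: det_trig; apply/is_trig_mxP => i j ij.
  by rewrite !mxE -val_eqE ltn_eqF // ltnNge ltnW // mulr0 addr0.
have unitT : T \in unitmx by rewrite unitmxE unitfE detT; apply/prodf_neq0.
have r0 : 0 < Num.sqrt rho2 by rewrite sqrtr_gt0.
have unitM : Num.sqrt rho2 *: invmx T \in unitmx.
  by rewrite unitmxZ ?unitmx_inv // unitfE gt_eqF.
have := Kmin (ellipsoid ((e *: w) *m invmx T) (Num.sqrt rho2 *: invmx T)).
rewrite lebesgue_ellipsoid // -[leLHS]mul1e lebesgue_ball_scale_le //.
move=> /(_ _ _)/wrap[||].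
- by apply/is_ellipsoidP; exists ((e *: w) *m invmx T), (Num.sqrt rho2 *: invmx T); rewrite row_free_unit.
- move=> x Kx; exists ((Num.sqrt rho2)^-1 *: (x *m T - e *: w)).
    rewrite unit_ballE dotZl dotZr mulrA -expr2 exprVn sqr_sqrtr ?(ltW rho0) //.
    by rewrite ler_pdivrMl // mulr1 inside // ltW.
  rewrite -(scalemxAr (Num.sqrt rho2)) -(scalemxAl (Num.sqrt rho2)^-1) scalerA.
  rewrite divff ?gt_eqF // scale1r mulmxBl addrC subrK.
  by rewrite mulmxK.
rewrite detZ det_inv normrM normfV ler_pdivlMr ?normr_gt0 -?unitfE -?unitmxE //.
rewrite mul1r -ler_sqr ?nnegrE // real_normK ?num_real // detT => h.
move: pe; rewrite ltNge => /negP; apply.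
rewrite hornerD hornerN !horner_prod subr_ge0.
rewrite (eq_bigr (fun i => T i i ^+ 2)) => [|i _]; last by rewrite Tdiag /g !hornerE; ring.
rewrite [leRHS](eq_bigr (fun=> rho2)) => [|i _]; last first.
  by rewrite /rho2 /f !(hornerD, hornerN, hornerZ, hornerXn, hornerX, hornerC); ring.
rewrite prodrXl prodr_const card_ord.
by apply: le_trans h _; rewrite real_normK ?num_real // exprAC sqr_sqrtr ?(ltW rho0) //.
Qed.

End JohnInequality.

(** * The volume bound for projections *)

Section ProjectionBound.
Variable R : realType.

Lemma dot_proj_le n k (A : 'M[R]_(k, n)) x : A *m A^T = 1%:M ->
  dot (x *m A^T) (x *m A^T) <= dot x x.
Proof.
move=> AA; have := dot_ge0 (x - x *m A^T *m A).
rewrite dotB [dot x (_ *m A)]dotC (dot_mull (x *m A^T)) (dot_orthonormal _ _ AA).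
lra.
Qed.

Lemma dilate_orth_proj_ball n k (A : 'M[R]_(k, n)) (F : {vspace 'rV[R]_n}) r :
  A *m A^T = 1%:M -> (forall v, v \in F <-> v *m A^T *m A = v) ->
  dilate r (orth_proj F (unit_ball R n)) = ellipsoid 0 (r *: A).
Proof.
move=> AA FA; rewrite (orth_projE _ AA FA); apply/seteqP; split.
  move=> _ [_ [x x1 <-] <-]; exists (x *m A^T).
    by move: x1; rewrite !unit_ballE; apply: le_trans; exact: dot_proj_le.
  by rewrite add0r -scalemxAr.
move=> _ [y y1 <-]; exists (y *m A); last by rewrite add0r -scalemxAr.
exists (y *m A); last by rewrite -[y *m A *m _]mulmxA AA mulmx1.
by move: y1; rewrite !unit_ballE dot_orthonormal.
Qed.

Lemma vol_scaled_orthonormal n k (A : 'M[R]_(k, n)) r : (0 < k)%N -> 0 < r ->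
  A *m A^T = 1%:M ->
  vol k (ellipsoid 0 (r *: A)) = lebesgue (dilate r (unit_ball R k)).
Proof.
move=> k0 r0 AA.
have Afree : row_free (r *: A).
  apply/inj_row_free => u; rewrite -scalemxAr => /eqP.
  rewrite scaler_eq0 gt_eqF //= => /eqP uA.
  by rewrite -[u]mulmx1 -AA mulmxA uA mul0mx.
rewrite vol_ellipsoid // lebesgue_dilate // linearZ /= -scalemxAl -scalemxAr AA scalerA.
rewrite scale_scalar_mx mulr1 det_scalar -expr2 exprAC sqrtr_sqr ger0_norm //.
by rewrite exprn_ge0 // ltW.
Qed.

(** Let [E] be [|(x A^T) S - b| <= 1] in orthonormal coordinates [x A^T] of
    [F]. The trace inequality for [G = A^T S] gives [tr (S^T S) <= n], whence
    [det S ^ 2 <= (n / k) ^ k]. Equality forces [S^T S = (n / k) 1], which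
    exhausts the trace inequality, so that [b = 0]. *)
Lemma projection_bound n k (K : set 'rV[R]_n) (F : {vspace 'rV[R]_n}) (E : set 'rV[R]_n) :
  (0 < k)%N -> (0 < n)%N -> is_loewner K (unit_ball R n) -> \dim F = k ->
  is_ellipsoid k E -> E `<=` [set` F] -> orth_proj F K `<=` E ->
  (lebesgue (dilate (Num.sqrt (k%:R / n%:R)) (unit_ball R k)) <= vol k E)%E /\
  (vol k E = lebesgue (dilate (Num.sqrt (k%:R / n%:R)) (unit_ball R k)) <->
   E = dilate (Num.sqrt (k%:R / n%:R)) (orth_proj F (unit_ball R n))).
Proof.
move=> k0 n0 Kmin Fk /is_ellipsoidP[c [M [Mfree EE]]] EF KE.
have [A [AA FA]] := subspace_orthonormal Fk.
have kR : (0 : R) < k%:R by rewrite ltr0n.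
have nR : (0 : R) < n%:R by rewrite ltr0n.
pose r : R := Num.sqrt (k%:R / n%:R).
have r0 : 0 < r by rewrite sqrtr_gt0 divr_gt0.
have r2 : r ^+ 2 = k%:R / n%:R by rewrite sqr_sqrtr // ltW // divr_gt0.
rewrite -/r; pose s : R := n%:R / k%:R.
have s0 : 0 < s by rewrite divr_gt0.
have sr : s * r ^+ 2 = 1 by rewrite r2 /s; field; rewrite !gt_eqF.
have cF : c *m A^T *m A = c.
  by apply/FA/EF; rewrite EE; exists 0; rewrite ?mul0mx ?addr0 //; exact: unit_ball0.
pose T := M *m A^T.
have MT : M = T *m A.
  apply/row_matrixP => i; rewrite /T !row_mul; apply/esym/FA.
  have -> : row i M = (c + row i M) - c by rewrite addrC addKr.
  apply: memvB; last exact/FA.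
  by apply: EF; rewrite EE; exists (delta_mx 0 i); rewrite -?rowE //; exact: unit_ball_delta.
have unitT : T \in unitmx.
  rewrite -row_free_unit; apply/inj_row_free => x xT.
  by apply/eqP; rewrite -(mulmx_free_eq0 _ Mfree) MT mulmxA xT mul0mx.
pose S := invmx T.
have dS : \det S = (\det T)^-1 by rewrite det_inv.
have dT : \det T != 0 by rewrite -unitfE -unitmxE.
have r2V : (r ^+ 2)^-1 = s.
  by rewrite -[LHS]mul1r -sr mulfK // expf_neq0 // gt_eqF.
pose b := c *m A^T *m S.
have trS : \tr (S^T *m S) + n%:R * dot b b <= n%:R.
  have -> : S^T *m S = (A^T *m S)^T *m (A^T *m S).
    by rewrite trmx_mul trmxK -!mulmxA [A *m (_ *m _)]mulmxA AA mul1mx.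
  apply: loewner_trace_le Kmin _ => // x Kx.
  have : E (x *m A^T *m A) by apply: KE; rewrite (orth_projE _ AA FA); exists x.
  rewrite EE => -[y y1 yE]; have -> : x *m (A^T *m S) - b = y; last by rewrite -unit_ballE.
  rewrite /b mulmxA -mulmxBl -[RHS](mulmxK unitT); congr (_ *m _).
  have := congr1 (mulmx^~ A^T) yE; rewrite MT -cF mulmxDl -!mulmxA AA !mulmx1 => <-.
  by rewrite addrC addKr.
have volE : vol k E = ((`|\det T|)%:E * lebesgue (unit_ball R k))%E.
  rewrite EE vol_ellipsoid // MT trmx_mul mulmxA -[T *m A *m _]mulmxA AA mulmx1.
  by rewrite det_mulmx det_tr -expr2 sqrtr_sqr.
have trS0 : \tr (S^T *m S) <= n%:R.
  by apply: le_trans trS; rewrite lerDl mulr_ge0 ?dot_ge0 // ltW.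
have detS : \det S ^+ 2 <= s ^+ k.
  apply: le_trans (det_le_trace S) _; rewrite lerXn2r ?nnegrE ?(ltW s0) //.
    rewrite divr_ge0 ?(ltW kR) // mxtrace_tr_mul; apply: sumr_ge0 => i _.
    by apply: sumr_ge0 => j _; rewrite sqr_ge0.
  by rewrite ler_wpM2r // invr_ge0 ltW.
have skE : s ^+ k = ((r ^+ k) ^+ 2)^-1.
  have : s ^+ k * (r ^+ k) ^+ 2 = 1 by rewrite exprAC -exprMn sr expr1n.
  by move/(canRL (mulfK _)) => ->; rewrite ?mul1r // !expf_neq0 // gt_eqF.
have det0 : 0 < \det T ^+ 2 by rewrite exprn_even_gt0 ?dT.
have rk0 : 0 < (r ^+ k) ^+ 2 by rewrite !exprn_gt0.
rewrite lebesgue_dilate // volE lebesgue_ball_scale_le //; split.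
  rewrite -ler_sqr ?nnegrE ?exprn_ge0 ?(ltW r0) // real_normK ?num_real //.
  by rewrite -lef_pV2 ?posrE // -skE -exprVn -dS.
rewrite (dilate_orth_proj_ball r AA FA); split=> [|E'].
  move/lebesgue_ball_scale_inj => /(_ k0) detT.
  have detSE : \det S ^+ 2 = s ^+ k.
    by rewrite dS skE -detT exprVn real_normK ?num_real.
  have sk : s * k%:R = n%:R by rewrite /s divfK // gt_eqF.
  have SS : S^T *m S = s%:M by apply: (det_eq_trace k0 s0 _ detSE); rewrite sk.
  have b0 : b = 0.
    apply/eqP; rewrite -dot_eq0 eq_le dot_ge0 andbT.
    move: trS; rewrite SS mxtrace_scalar -[s *+ k]mulr_natr sk gerDl.
    by rewrite pmulr_rle0.
  have c0 : c = 0.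
    by rewrite -cF -[c *m A^T](mulmxK (_ : S \in unitmx)) ?unitmx_inv // -/b b0 !mul0mx.
  have SS' : S *m S^T = s%:M.
    have : (s^-1 *: S^T) *m S = 1%:M.
      by rewrite -scalemxAl SS scale_scalar_mx mulVf ?gt_eqF.
    move/mulmx1C; rewrite -scalemxAr => /(congr1 (fun X => s *: X)).
    by rewrite scalerA divff ?gt_eqF // scale1r => ->; rewrite scale_scalar_mx mulr1.
  have ST : S *m T = 1%:M by rewrite mulVmx.
  have TS : T *m S = 1%:M by rewrite mulmxV.
  rewrite EE c0; apply/seteqP; split => _ [y y1 <-].
    exists (r^-1 *: (y *m T)); last first.
      by rewrite -scalemxAr -scalemxAl scalerA divff ?gt_eqF // scale1r MT mulmxA.
    have : dot y y = s * dot (y *m T) (y *m T).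
      rewrite -{1 2}[y]mulmx1 -TS mulmxA [in LHS]dot_mull -[_ *m S *m S^T]mulmxA SS'.
      by rewrite mul_mx_scalar dotZr.
    move: y1; rewrite !unit_ballE !dotZl !dotZr => y1 yE.
    by rewrite mulrA -expr2 exprVn r2V -yE.
  exists (r *: (y *m S)); last first.
    by rewrite -scalemxAr -scalemxAl MT mulmxA -[y *m S *m T]mulmxA ST mulmx1.
  have yS : dot (y *m S) (y *m S) = s * dot y y.
    by rewrite dot_mull -mulmxA SS' mul_mx_scalar dotZr.
  rewrite unit_ballE dotZl dotZr yS (_ : r * _ = s * r ^+ 2 * dot y y); last by ring.
  by rewrite sr mul1r -unit_ballE.
by rewrite -volE E' vol_scaled_orthonormal // lebesgue_dilate.
Qed.

End ProjectionBound.

(** * John's condition *)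

Section JohnPosition.
Variable R : realType.

(** John's condition: contact points with weights that make up a centred
    decomposition of the identity. Asking for the convex hull of the points
    makes the condition monotone in [K] without convexity of [K]. *)
Definition john_position n (K : set 'rV[R]_n) : Prop :=
  exists (I : finType) (u : I -> 'rV[R]_n) (lam : I -> R),
   [/\ forall i, 0 <= lam i, \sum_i lam i = n%:R, \sum_i lam i *: u i = 0,
       \sum_i lam i *: ((u i)^T *m u i) = 1%:M & conv_hull u `<=` K].

Lemma conv_hull_vertex (I : finType) n (p : I -> 'rV[R]_n) i : conv_hull p (p i).
Proof.
exists (fun j => (j == i)%:R); split => [j||]; first by case: (j == i).
  by rewrite (bigD1 i) //= eqxx big1 ?addr0 // => j /negbTE ->.
rewrite (bigD1 i) //= eqxx scale1r big1 ?addr0 // => j /negbTE ->.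
by rewrite scale0r.
Qed.

Lemma enorm_sum_le (I : finType) n (w : I -> R) (p : I -> 'rV[R]_n) r :
  (forall i, enorm (p i) <= r) -> enorm (\sum_i w i *: p i) <= (\sum_i `|w i|) * r.
Proof.
move=> pr; rewrite mulr_suml.
elim/big_rec2: _ => [|i y x _ xy]; first by rewrite enorm0.
apply: le_trans (enorm_triangle _ _) _; rewrite lerD //.
by rewrite enormZ ler_wpM2l.
Qed.

Lemma enorm_conv_hull (I : finType) n m (p : I -> 'rV[R]_n) (B : 'M[R]_(n, m)) r x :
  (forall i, enorm (p i *m B) <= r) -> conv_hull p x -> enorm (x *m B) <= r.
Proof.
move=> pr [w [w0 w1 ->]]; rewrite mulmx_suml.
under eq_bigr do rewrite -scalemxAl.
apply: le_trans (enorm_sum_le _ pr) _.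
by under eq_bigr => i _ do rewrite ger0_norm //; rewrite w1 mul1r.
Qed.

(** Summing [|(u i - c) S| <= 1] against the weights gives
    [tr (S^T S) + n |c S|^2 <= n] for every ellipsoid
    [|(x - c) S| <= 1] around the contact points, hence [|det S| <= 1]. *)
Lemma john_is_loewner n (K : set 'rV[R]_n) : (0 < n)%N ->
  K `<=` unit_ball R n -> john_position K -> is_loewner K (unit_ball R n).
Proof.
move=> n0 KB [I [u [lam [lam0 lamn lamu lamuu uK]]]].
have nR : (0 : R) < n%:R by rewrite ltr0n.
split => //.
  apply/is_ellipsoidP; exists 0, 1%:M; split; first by rewrite row_free_unit unitmx1.
  by apply/seteqP; split => [x x1|_ [x x1 <-]]; [exists x|]; rewrite ?mulmx1 ?add0r.
move=> E' /is_ellipsoidP[c [M [Mfree ->]]] KE.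
have unitM : M \in unitmx by rewrite -row_free_unit.
rewrite lebesgue_ellipsoid // -[leLHS]mul1e lebesgue_ball_scale_le //.
pose S := invmx M.
have uS i : dot (u i *m S - c *m S) (u i *m S - c *m S) <= 1.
  have [y y1 yu] : ellipsoid c M (u i) by apply/KE/uK/conv_hull_vertex.
  by rewrite -mulmxBl -yu addrC addKr mulmxK // -unit_ballE.
have uSsum : \sum_i lam i * dot (u i *m S) (u i *m S) = \tr (S^T *m S).
  rewrite -[S^T]mulmx1 -mulmxA mulmxA -lamuu mulmx_sumr mulmx_suml raddf_sum /=.
  apply: eq_bigr => i _; rewrite -scalemxAr -scalemxAl mxtraceZ; congr (_ * _).
  by rewrite !mulmxA -trmx_mul -mulmxA mxtrace_mulC dot_mx mxtrace_scalar.
have ucsum : \sum_i lam i * dot (u i *m S) (c *m S) = 0.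
  rewrite (eq_bigr (fun i => dot (lam i *: u i *m S) (c *m S))) => [|i _]; last first.
    by rewrite -scalemxAl dotZl.
  by rewrite -dot_suml -mulmx_suml lamu mul0mx dot0l.
have trS : \tr (S^T *m S) + n%:R * dot (c *m S) (c *m S) <= n%:R.
  have <- : \sum_i lam i * dot (u i *m S - c *m S) (u i *m S - c *m S) =
      \tr (S^T *m S) + n%:R * dot (c *m S) (c *m S).
    rewrite (eq_bigr (fun i => lam i * dot (u i *m S) (u i *m S) -
        2 * (lam i * dot (u i *m S) (c *m S)) + lam i * dot (c *m S) (c *m S))) => [|i _].
      by rewrite big_split sumrB /= -mulr_sumr ucsum mulr0 subr0 uSsum -mulr_suml lamn.
    by rewrite dotB; ring.
  by rewrite -[leRHS]lamn ler_sum // => i _; rewrite -[leRHS]mulr1 ler_wpM2l.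
have trS0 : \tr (S^T *m S) / n%:R <= 1.
  by rewrite ler_pdivrMr // mul1r; apply: le_trans trS; rewrite lerDl mulr_ge0 ?dot_ge0 // ltW.
have : \det S ^+ 2 <= 1.
  apply: le_trans (det_le_trace S) _; apply: exprn_ile1 => //.
  rewrite divr_ge0 ?(ltW nR) // -uSsum sumr_ge0 // => i _.
  by rewrite mulr_ge0 ?dot_ge0.
rewrite det_inv exprVn invf_le1; last first.
  by rewrite exprn_even_gt0 //= -unitfE -unitmxE.
by rewrite -real_normK ?num_real // expr_ge1.
Qed.

(** If [|x| <= 1/n] then [x = \sum_i lam i (1/n + <x, u i>) u i] is a convex
    combination of the contact points. *)
Lemma john_position_ball n (K : set 'rV[R]_n) x : (0 < n)%N ->
  K `<=` unit_ball R n -> john_position K -> enorm x <= n%:R^-1 -> K x.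
Proof.
move=> n0 KB [I [u [lam [lam0 lamn lamu lamuu uK]]]] xn.
have nR : (0 : R) < n%:R by rewrite ltr0n.
apply: (uK); exists (fun i => lam i * (n%:R^-1 + dot x (u i))); split.
- move=> i; rewrite mulr_ge0 // addrC -[n%:R^-1]opprK subr_ge0.
  rewrite lerNl -dotNl; apply: le_trans (dot_le_enorm _ _) _; rewrite enormN -[leRHS]mulr1.
  by rewrite ler_pM ?enorm_ge0 //; apply/KB/uK/conv_hull_vertex.
- under eq_bigr do rewrite mulrDr.
  rewrite big_split /= -mulr_suml lamn divff ?gt_eqF //.
  under eq_bigr do rewrite dotC -dotZl.
  by rewrite -dot_suml lamu dot0l addr0.
- rewrite (eq_bigr (fun i => n%:R^-1 *: (lam i *: u i) + (lam i * dot x (u i)) *: u i)); last first.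
    by move=> i _; rewrite mulrDr scalerDl scalerA [n%:R^-1 * _]mulrC.
  rewrite big_split /= -scaler_sumr lamu scaler0 add0r.
  rewrite -[LHS]mulmx1 -lamuu mulmx_sumr; apply: eq_bigr => i _.
  by rewrite -scalemxAr mulmxA dot_mx mul_scalar_mx scalerA.
Qed.

Lemma john_position_interior n (K : set 'rV[R]_n) : (0 < n)%N ->
  K `<=` unit_ball R n -> john_position K -> K° !=set0.
Proof.
move=> n0 KB KJ; exists 0; apply/nbhs_ballP.
have nR : (0 : R) < n%:R by rewrite ltr0n.
have e0 : (0 : R) < (n%:R ^+ 2)^-1 by rewrite invr_gt0 exprn_gt0.
exists (n%:R ^+ 2)^-1 => // x [_ x0]; apply: john_position_ball => //.
have ni0 : (0 : R) < n%:R^-1 by rewrite invr_gt0.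
rewrite enorm_le ?(ltW ni0) // /dot.
apply: le_trans (_ : \sum_(j < n) ((n%:R ^+ 2)^-1) ^+ 2 <= _).
  apply: ler_sum => j _; rewrite -expr2 -real_normK ?num_real //.
  rewrite ler_sqr ?nnegrE ?(ltW e0) //.
  have : `|(0 : 'rV[R]_n) 0 j - x 0 j| < (n%:R ^+ 2)^-1 := x0 0 j.
  by rewrite mxE sub0r normrN => /ltW.
rewrite sumr_const card_ord -[leLHS]mulr_natr.
rewrite (_ : ((n%:R ^+ 2)^-1 ^+ 2 * n%:R) = n%:R^-1 ^+ 3 :> R); last first.
  by field; rewrite gt_eqF.
by rewrite ler_wiXn2l ?(ltW ni0) // invf_le1 // ler1n.
Qed.

End JohnPosition.

(** * Compactness of hulls and Minkowski combinations *)

Section CompactCombinations.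
Variable R : realType.

Lemma continuous_mulmxr m n (P : 'M[R]_(m, n)) :
  continuous (fun w : 'rV[R]_m => w *m P).
Proof.
have -> : (fun w : 'rV[R]_m => w *m P) = (fun w => \sum_i w 0 i *: row i P).
  by apply/funext => w; rewrite mulmx_sum_row.
move=> w; apply: (@cvg_big _ _ _ _ _ add_continuous _ (nbhs w)) => i _.
by apply: cvgZr_tmp; exact: coord_continuous.
Qed.

Lemma continuous_enorm_mulmxr m n (P : 'M[R]_(m, n)) :
  continuous (fun w : 'rV[R]_m => enorm (w *m P)).
Proof.
move=> w; pose f (v : 'rV[R]_m) := dot (v *m P) (v *m P).
suff cf : f v @[v --> w] --> f w by exact: (cvg_comp _ _ cf (@sqrt_continuous R (f w))).
apply: (@cvg_big _ _ _ _ _ add_continuous _ (nbhs w)) => j _.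
have cj : (v *m P) 0 j @[v --> w] --> (w *m P) 0 j.
  exact: (cvg_comp _ _ (@continuous_mulmxr _ _ P w) (@coord_continuous _ _ _ 0 j _)).
exact: cvgM.
Qed.

Lemma bounded_ball n (K : set 'rV[R]_n) : K `<=` unit_ball R n -> bounded_set K.
Proof.
move=> KB; exists 1; split; first exact: num_real.
move=> M M1 x /KB x1; rewrite /Num.norm /= mx_normrE; apply/bigmax_leP; split => /=.
  by apply: le_trans (ltW M1).
move=> [i j] _ /=; rewrite (ord1 i); apply: le_trans (le_coord_enorm x j) _.
exact: le_trans x1 (ltW M1).
Qed.

Lemma compact_mulmxr_image m n (P : 'M[R]_(m, n)) (X : set 'rV[R]_m) :
  compact X -> compact [set x *m P | x in X].
Proof.
by apply: continuous_compact; apply: continuous_subspaceT; exact: continuous_mulmxr.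
Qed.

(** The hull is the image of the standard simplex under a linear map. *)
Lemma compact_conv_hull (I : finType) n (p : I -> 'rV[R]_n) : compact (conv_hull p).
Proof.
pose P := \matrix_(i < #|I|) p (enum_val i).
pose Delta := [set w : 'rV[R]_#|I| | forall j, w 0 j \in `[0, 1]] `&`
  [set w | w *m const_mx 1 = (1%:M : 'M[R]_1)].
have -> : conv_hull p = [set w *m P | w in Delta].
  apply/seteqP; split => [x [w [w0 w1 ->]]|_ [w [w01 w1] <-]].
    have wE j : (\row_i w (enum_val i) : 'rV_#|I|) 0 j = w (enum_val j) by rewrite mxE.
    exists (\row_i w (enum_val i)); last first.
      rewrite mulmx_sum_row [RHS](reindex _ (onW_bij _ (@enum_val_bij I))) /=.
      by apply: eq_bigr => i _; rewrite wE rowK.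
    split => /=.
      move=> j; rewrite wE in_itv /= w0 -w1 (bigD1 (enum_val j)) //= lerDl.
      by apply: sumr_ge0.
    apply/matrixP => i j; rewrite !ord1 [RHS]mxE eqxx mulr1n -[RHS]w1 mxE.
    rewrite [RHS](reindex _ (onW_bij _ (@enum_val_bij I))) /=.
    by apply: eq_bigr => l _; rewrite !mxE mulr1.
  exists (fun i => w 0 (enum_rank i)); split.
  - by move=> i; have := w01 (enum_rank i); rewrite in_itv /= => /andP[].
  - rewrite (reindex _ (onW_bij _ (@enum_val_bij I))) /=.
    have := congr1 (fun A : 'M[R]_1 => A 0 0) w1; rewrite mxE [RHS]mxE eqxx mulr1n => <-.
    by apply: eq_bigr => l _; rewrite enum_valK !mxE mulr1.
  - rewrite mulmx_sum_row [RHS](reindex _ (onW_bij _ (@enum_val_bij I))) /=.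
    by apply: eq_bigr => i _; rewrite rowK enum_valK.
apply: compact_mulmxr_image; apply: compact_closedI.
  exact: (@rV_compact R _ (fun=> `[0, 1]%classic) (fun=> @segment_compact R 0 1)).
have c1 : closed [set (1%:M : 'M[R]_1)].
  by apply: accessible_closed_set1; apply: hausdorff_accessible; exact: norm_hausdorff.
by apply: (preimage_closed _ c1) => w _; exact: continuous_mulmxr.
Qed.

(** A Minkowski combination. The sets and the coefficients are indexed by [nat],
    so that compactness is proved by induction on [m]. *)
Definition mink n (m : nat) (w : nat -> R) (Q : nat -> set 'rV[R]_n) : set 'rV[R]_n :=
  [set x | exists2 q : nat -> 'rV[R]_n,
     forall i, (i < m)%N -> Q i (q i) & x = \sum_(i < m) w i *: q i].

Lemma compact_mink n m w (Q : nat -> set 'rV[R]_n) :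
  (forall i, (i < m)%N -> compact (Q i)) -> compact (mink m w Q).
Proof.
elim: m => [_|m IH Qc].
  have -> : mink 0 w Q = [set 0].
    apply/seteqP; split => [x [q _ ->]|_ ->]; first by rewrite big_ord0.
    by exists (fun=> 0); rewrite ?big_ord0.
  exact: compact_set1.
have -> : mink m.+1 w Q =
    [set xy.1 + w m *: xy.2 | xy in mink m w Q `*` Q m].
  apply/seteqP; split => [x [q Qq ->]|_ [[x y] /= [[q Qq ->] Qy] <-]].
    exists (\sum_(i < m) w i *: q i, q m) => /=; last by rewrite big_ord_recr.
    by split; [exists q => // i im; apply/Qq/ltnW|apply: Qq].
  exists (fun i => if i == m then y else q i) => [i|].
    by rewrite ltnS leq_eqVlt; case: eqP => [->|_] //= /Qq.
  rewrite big_ord_recr /= eqxx; congr (_ + _); apply: eq_bigr => i _.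
  by rewrite ltn_eqF.
apply: continuous_compact; last first.
  by apply: compact_setX; [apply: IH => i im; apply/Qc/ltnW|apply: Qc].
apply: continuous_subspaceT => xy; apply: cvgD; first exact: cvg_fst.
by apply: cvgZl_tmp; exact: cvg_snd.
Qed.

End CompactCombinations.

(** * Discrete harmonics *)

Section Harmonics.
Variable R : realType.
Implicit Types (m i j : nat) (b : bool).

Definition angle m i : R := (pi *+ 2) * i%:R / m%:R.

Lemma angle_natmul m i j : angle m i *+ j = 2 * pi * i%:R * j%:R / m%:R.
Proof. by rewrite -[LHS]mulr_natr /angle -(mulr_natl pi); ring. Qed.

(** [cos (j t)] for [b = false], [sin (j t)] for [b = true], at the [i]-th
    vertex [t] of the regular [m]-gon. *)
Definition harmonic m j b i : R := cos (angle m i *+ j - b%:R * (pi / 2)).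

Lemma harmonic_sqr m j i : harmonic m j false i ^+ 2 + harmonic m j true i ^+ 2 = 1.
Proof. by rewrite /harmonic mul0r subr0 mul1r cosBpihalf cos2Dsin2. Qed.

(** Multiplied by [2 sin (a / 2)], with [a] the step of the argument, the sum
    telescopes over a whole number of periods. *)
Lemma sum_cos m j (c : R) : (0 < j < m)%N ->
  \sum_(i < m) cos (angle m i *+ j + c) = 0.
Proof.
move=> /andP[j0 jm]; have mR : (0 : R) < m%:R by rewrite ltr0n (leq_trans _ jm).
pose h : R := pi * j%:R / m%:R.
have sh : 0 < sin h.
  apply: sin_gt0_pi; rewrite /h divr_gt0 ?mulr_gt0 ?pi_gt0 ?ltr0n ?(leq_trans _ jm) //=.
  by rewrite ltr_pdivrMr // ltr_pM2l ?pi_gt0 // ltr_nat.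
pose g i := sin (angle m i *+ j + c - h).
have step i : 2 * sin h * cos (angle m i *+ j + c) = g i.+1 - g i.
  have -> : g i.+1 = sin (angle m i *+ j + c + h).
    congr (sin _); rewrite !angle_natmul /h -natr1; field.
    by rewrite gt_eqF.
  by rewrite /g sinD sinB; ring.
suff : 2 * sin h * \sum_(i < m) cos (angle m i *+ j + c) = 0.
  by move/eqP; rewrite !mulf_eq0 pnatr_eq0 (gt_eqF sh) => /eqP.
rewrite mulr_sumr; under eq_bigr do rewrite step.
rewrite -(big_mkord xpredT (fun i => g i.+1 - g i)) telescope_sumr //.
have -> : g m = sin (c - h + (pi *+ 2) *+ j).
  congr (sin _); rewrite angle_natmul -[pi *+ 2 *+ j]mulr_natr -(mulr_natl pi).
  by field; rewrite gt_eqF.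
by rewrite (periodicn (@sinD2pi R)) /g angle_natmul mulr0 !mul0r add0r subrr.
Qed.

Lemma sum_harmonic m j b : (0 < j < m)%N -> \sum_(i < m) harmonic m j b i = 0.
Proof. exact: sum_cos. Qed.

Lemma harmonic_orthogonal m j j' b b' : (0 < j)%N -> (0 < j')%N -> (j + j' < m)%N ->
  \sum_(i < m) harmonic m j b i * harmonic m j' b' i =
  m%:R / 2 * ((j == j') && (b == b'))%:R.
Proof.
move=> j0 j'0 jj'.
pose c : R := b%:R * (pi / 2); pose c' : R := b'%:R * (pi / 2).
have prodE i : harmonic m j b i * harmonic m j' b' i =
    (cos (angle m i *+ j - angle m i *+ j' + (c' - c)) +
     cos (angle m i *+ (j + j') + (- c - c'))) / 2.
  rewrite /harmonic mulrnDr -/c -/c'.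
  set x := _ *+ j - c; set y := _ *+ j' - c'.
  rewrite (_ : _ - _ + (c' - c) = x - y); last by rewrite /x /y; ring.
  rewrite (_ : _ + _ + (- c - c') = x + y); last by rewrite /x /y; ring.
  by rewrite (cosB x y) (cosD x y); field.
under eq_bigr do rewrite prodE.
rewrite -mulr_suml big_split /= sum_cos ?addr0; last by rewrite jj' addn_gt0 j0.
have [<-|neq] /= := eqVneq j j'.
  rewrite (eq_bigr (fun=> (b == b')%:R)) => [|i _].
    by rewrite sumr_const card_ord -mulr_natr; ring.
  rewrite subrr add0r /c /c'; case: b b' {prodE c c'} => -[] /=.
  - by rewrite subrr cos0.
  - by rewrite mul0r sub0r mul1r cosN cos_pihalf.
  - by rewrite mul0r subr0 mul1r cos_pihalf.
  - by rewrite subrr cos0.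
rewrite mulr0; apply/eqP; rewrite mulf_eq0 invr_eq0 pnatr_eq0 orbF; apply/eqP.
have [lt|lt|E] := ltngtP j j'; last by rewrite E eqxx in neq.
  rewrite (eq_bigr (fun i : 'I_m => cos (angle m i *+ (j' - j) + (c - c')))) => [|i _].
    by rewrite sum_cos //; move: jj' lt; lia.
  by rewrite -cosN mulrnBr ?(ltnW lt) //; congr (cos _); ring.
rewrite (eq_bigr (fun i : 'I_m => cos (angle m i *+ (j - j') + (c' - c)))) => [|i _].
  by rewrite sum_cos //; move: jj' lt; lia.
by rewrite mulrnBr ?(ltnW lt).
Qed.

End Harmonics.

(** * Equal-norm tight frames *)

Section TightFrames.
Variable R : realType.

(** The columns of [G] form an equal-norm tight frame; in other words, [G^T G]
    is an orthogonal projection of rank [k] with constant diagonal. *)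
Definition tight_frame k N (G : 'M[R]_(k, N)) : Prop :=
  G *m G^T = 1%:M /\ forall i, \sum_a G a i ^+ 2 = k%:R / N%:R.

Definition zero_sum k N (G : 'M[R]_(k, N)) : Prop := forall a, \sum_i G a i = 0.

Lemma frame_matrix (J C : finType) (f : J -> C -> R) k N : #|J| = k -> #|C| = N ->
  (forall a a', \sum_c f a c * f a' c = (a == a')%:R) ->
  (forall c, \sum_a f a c ^+ 2 = k%:R / N%:R) ->
  exists2 G : 'M[R]_(k, N), tight_frame G &
    (forall a, \sum_c f a c = 0) -> zero_sum G.
Proof.
move=> <- <- orth norm.
have sumJ (F : J -> R) : \sum_(a < #|J|) F (enum_val a) = \sum_a F a.
  by rewrite [RHS](reindex _ (onW_bij _ (@enum_val_bij J))).
have sumC (F : C -> R) : \sum_(c < #|C|) F (enum_val c) = \sum_c F c.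
  by rewrite [RHS](reindex _ (onW_bij _ (@enum_val_bij C))).
exists (\matrix_(a, c) f (enum_val a) (enum_val c)).
  split=> [|c]; last first.
    by rewrite -(norm (enum_val c)) -(sumJ (fun a => f a (enum_val c) ^+ 2)); apply: eq_bigr => a _; rewrite mxE.
  apply/matrixP => a a'; rewrite !mxE -(inj_eq enum_val_inj) -orth -(sumC (fun c => f _ c * f _ c)).
  by apply: eq_bigr => c _; rewrite !mxE.
by move=> f0 a; rewrite -[RHS](f0 (enum_val a)) -(sumC (f (enum_val a))); apply: eq_bigr => c _; rewrite mxE.
Qed.

Lemma sum_harmonics_sqr q m i (r : R) :
  \sum_(p : 'I_q * bool) (r * harmonic R m p.1.+1 p.2 i) ^+ 2 = q%:R * r ^+ 2.
Proof.
rewrite -(pair_bigA _ (fun (a : 'I_q) b => (r * harmonic R m a.+1 b i) ^+ 2)) /=.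
rewrite (eq_bigr (fun=> r ^+ 2)) => [|a _]; first by rewrite sumr_const card_ord mulr_natl.
by rewrite big_bool /= !exprMn -mulrDr addrC harmonic_sqr mulr1.
Qed.

Lemma harmonics_orthogonal q m (p p' : 'I_q * bool) : (q.*2 < m)%N ->
  \sum_(i < m) harmonic R m p.1.+1 p.2 i * harmonic R m p'.1.+1 p'.2 i =
  m%:R / 2 * (p == p')%:R.
Proof.
move=> qm; rewrite harmonic_orthogonal ?eqSS //.
by move: (ltn_ord p.1) (ltn_ord p'.1) qm; lia.
Qed.

Lemma sum_harmonics q m (p : 'I_q * bool) : (q.*2 < m)%N ->
  \sum_(i < m) harmonic R m p.1.+1 p.2 i = 0.
Proof. by move=> qm; apply: sum_harmonic; move: (ltn_ord p.1) qm; lia. Qed.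

(** The rows are the cosines and sines of the frequencies 1, ..., [q], which are
    below [N / 2]. *)
Lemma even_frame q N : (q.*2 < N)%N ->
  exists2 G : 'M[R]_(q.*2, N), tight_frame G & zero_sum G.
Proof.
move=> qN; have NR : (0 : R) < N%:R by rewrite ltr0n (leq_ltn_trans _ qN).
pose r : R := Num.sqrt (2 / N%:R).
have r2 : r ^+ 2 = 2 / N%:R by rewrite sqr_sqrtr // divr_ge0 // ltW.
have [||p p'|i|G Gt Gz] := @frame_matrix ('I_q * bool)%type 'I_N
    (fun p i => r * harmonic R N p.1.+1 p.2 i) q.*2 N.
- by rewrite card_prod card_ord card_bool muln2.
- by rewrite card_ord.
- under eq_bigr do rewrite mulrACA -expr2 r2.
  rewrite -mulr_sumr harmonics_orthogonal // mulrA.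
  by rewrite (_ : 2 / N%:R * (N%:R / 2) = 1 :> R) ?mul1r //; field; rewrite gt_eqF.
- by rewrite sum_harmonics_sqr r2 -muln2 natrM mulrA.
- by exists G => //; apply: Gz => p; rewrite -mulr_sumr sum_harmonics ?mulr0.
Qed.

Lemma odd_frame q N (C : finType) (e : C -> R) (h : 'I_q * bool -> C -> R) :
  #|C| = N -> \sum_c e c ^+ 2 = 1 -> (forall p, \sum_c e c * h p c = 0) ->
  (forall p p', \sum_c h p c * h p' c = (p == p')%:R) ->
  (forall c, e c ^+ 2 + \sum_p h p c ^+ 2 = (q.*2.+1)%:R / N%:R) ->
  exists2 G : 'M[R]_(q.*2.+1, N), tight_frame G &
    \sum_c e c = 0 -> (forall p, \sum_c h p c = 0) -> zero_sum G.
Proof.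
move=> CN e1 eh hh norm.
have sumO (F : option ('I_q * bool) -> R) : \sum_a F a = F None + \sum_p F (Some p).
  rewrite (bigD1 None) //=; congr (_ + _).
  rewrite (reindex_omap Some id) => [|[p|] //]; apply: eq_bigl => p.
  by rewrite /= eqxx.
have [||[p|] [p'|]|c|G Gt Gz] := @frame_matrix (option ('I_q * bool)) C
    (fun a c => if a is Some p then h p c else e c) q.*2.+1 N.
- by rewrite card_option card_prod card_ord card_bool muln2.
- by [].
- by rewrite hh.
- by rewrite -[RHS](eh p); apply: eq_bigr => c _; rewrite mulrC.
- by rewrite eh.
- by under eq_bigr do rewrite -expr2; rewrite e1.
- by rewrite sumO norm.
- by exists G => // e0 h0; apply: Gz => -[p|].
Qed.

Lemma natr_doubleS q : q.*2.+1%:R = 2 * q%:R + 1 :> R.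
Proof. by rewrite -[LHS]natr1 -muln2 natrM mulrC. Qed.

Lemma single_block_frame q N (e : 'I_N -> R) : (q.*2 < N)%N ->
  (forall i, e i ^+ 2 = N%:R^-1) ->
  (forall p : 'I_q * bool, \sum_(i < N) e i * harmonic R N p.1.+1 p.2 i = 0) ->
  exists2 G : 'M[R]_(q.*2.+1, N), tight_frame G & \sum_i e i = 0 -> zero_sum G.
Proof.
move=> qN e2 eh; have NR : (0 : R) < N%:R by rewrite ltr0n (leq_ltn_trans _ qN).
pose r : R := Num.sqrt (2 / N%:R).
have r2 : r ^+ 2 = 2 / N%:R by rewrite sqr_sqrtr // divr_ge0 // ltW.
have [|||p p'|i|G Gt Gz] := @odd_frame q N 'I_N e
    (fun p i => r * harmonic R N p.1.+1 p.2 i).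
- by rewrite card_ord.
- by rewrite (eq_bigr (fun=> N%:R^-1)) // sumr_const card_ord -[LHS]mulr_natr mulVf ?gt_eqF.
- by move=> p; under eq_bigr do rewrite mulrCA; rewrite -mulr_sumr eh mulr0.
- under eq_bigr do rewrite mulrACA -expr2 r2.
  rewrite -mulr_sumr harmonics_orthogonal // mulrA.
  by rewrite (_ : 2 / N%:R * (N%:R / 2) = 1 :> R) ?mul1r //; field; rewrite gt_eqF.
- by rewrite sum_harmonics_sqr e2 r2 natr_doubleS; field; rewrite gt_eqF.
exists G => // e0; apply: Gz => // p.
by rewrite -mulr_sumr sum_harmonics ?mulr0.
Qed.

(** The parity of [k] decides whether the constant row joins the harmonics. *)
Lemma tight_frame_exists k N : (0 < k < N)%N -> exists G : 'M[R]_(k, N), tight_frame G.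
Proof.
move=> /andP[k0 kN]; have N0 : (0 < N)%N by apply: leq_trans kN.
case: (boolP (odd k)) => kodd.
  have kE : k = (k./2).*2.+1 by move: kodd; lia.
  have qN : ((k./2).*2 < N)%N by lia.
  have [|p|G Gt _] := @single_block_frame k./2 N (fun=> (Num.sqrt N%:R)^-1) qN.
  - by rewrite exprVn sqr_sqrtr.
  - by rewrite -mulr_sumr sum_harmonics ?mulr0.
  - by rewrite kE; exists G.
have kE : k = (k./2).*2 by move: kodd; lia.
have [|G Gt _] := @even_frame k./2 N; first by lia.
by rewrite kE; exists G.
Qed.

(** The additional row is the cosine of the frequency [f = N / 2], i.e., the row of
    alternating signs. *)
Lemma alternating_frame q f : (q < f)%N ->
  exists2 G : 'M[R]_(q.*2.+1, f.*2), tight_frame G & zero_sum G.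
Proof.
move=> qf; have f0 : (0 : R) < f%:R by rewrite ltr0n (leq_ltn_trans _ qf).
have NE : f.*2%:R = 2 * f%:R :> R by rewrite -muln2 natrM mulrC.
have sinf i : harmonic R f.*2 f true i = 0.
  rewrite /harmonic mul1r cosBpihalf.
  have -> : angle R f.*2 i *+ f = 0 + pi *+ i.
    by rewrite angle_natmul NE add0r -[RHS]mulr_natr; field; rewrite gt_eqF.
  elim: i => [|i IH]; first by rewrite addr0 sin0.
  by rewrite mulrSr addrA sinDpi IH oppr0.
have [|i|p|G Gt Gz] := @single_block_frame q f.*2
    (fun i => (Num.sqrt f.*2%:R)^-1 * harmonic R f.*2 f false i).
- by rewrite ltn_double.
- rewrite exprMn exprVn sqr_sqrtr //; have := harmonic_sqr R f.*2 f i.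
  by rewrite sinf expr0n /= addr0 => ->; rewrite mulr1.
- under eq_bigr do rewrite -mulrA; rewrite -mulr_sumr harmonic_orthogonal //.
  + by rewrite gtn_eqF ?mulr0 // (leq_ltn_trans _ qf).
  + by rewrite (leq_ltn_trans _ qf).
  + by move: (ltn_ord p.1) qf; lia.
exists G => //; apply: Gz; rewrite -mulr_sumr sum_harmonic ?mulr0 //.
by move: qf; lia.
Qed.

(** For [q = 1] the columns are the vertices of a regular [m]-gon and of a
    regular [(m + 1)]-gon at the heights [t / m] and [- t / (m + 1)], with the
    radii that put all of them on one sphere. *)
Lemma two_block_frame q m : (0 < q)%N -> (q.*2 < m)%N ->
  exists2 G : 'M[R]_(q.*2.+1, m + m.+1), tight_frame G & zero_sum G.
Proof.
move=> q0 qm.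
have qR : (1 : R) <= q%:R by rewrite ler1n.
have mR : (1 : R) <= m%:R by rewrite ler1n (leq_ltn_trans _ qm).
have [a aE] : exists a : R, a = m%:R by exists m%:R.
have [b bE'] : exists b : R, b = m.+1%:R by exists m.+1%:R.
have bE : b = a + 1 by rewrite bE' aE -natr1.
have NE : (m + m.+1)%:R = a + b :> R by rewrite natrD aE bE'.
have a1 : 1 <= a by rewrite aE.
have b1 : 1 <= b by rewrite bE; lra.
have a0 : a != 0 by rewrite gt_eqF //; lra.
have b0 : b != 0 by rewrite gt_eqF //; lra.
have ab0 : a + b != 0 by rewrite gt_eqF //; lra.
have q0' : q%:R != 0 :> R by rewrite gt_eqF //; lra.
pose t := Num.sqrt (a * b / (a + b)).
have t2 : t ^+ 2 = a * b / (a + b).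
  by rewrite sqr_sqrtr // divr_ge0 ?mulr_ge0 ?addr_ge0 //; lra.
pose K : R := (q.*2.+1)%:R.
have KE : K = 2 * q%:R + 1 := natr_doubleS q.
pose x1 := (K / (a + b) - (t / a) ^+ 2) / q%:R.
pose x2 := (K / (a + b) - (t / b) ^+ 2) / q%:R.
have x1E : x1 = (K - b / a) / ((a + b) * q%:R).
  by rewrite /x1 exprMn t2 exprVn; field; rewrite ?a0 ?b0 ?ab0 ?q0'.
have x2E : x2 = (K - a / b) / ((a + b) * q%:R).
  by rewrite /x2 exprMn t2 exprVn; field; rewrite ?a0 ?b0 ?ab0 ?q0'.
have x10 : 0 <= x1.
  have Kb : b / a <= K by rewrite ler_pdivrMr; [rewrite bE KE; nra|lra].
  by rewrite x1E divr_ge0 ?subr_ge0 // mulr_ge0 //; lra.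
have x20 : 0 <= x2.
  have Ka : a / b <= K by rewrite ler_pdivrMr; [rewrite bE KE; nra|lra].
  by rewrite x2E divr_ge0 ?subr_ge0 // mulr_ge0 //; lra.
pose r1 := Num.sqrt x1; pose r2 := Num.sqrt x2.
have r12 : r1 ^+ 2 = x1 by rewrite sqr_sqrtr.
have r22 : r2 ^+ 2 = x2 by rewrite sqr_sqrtr.
have sumS (F : 'I_m + 'I_m.+1 -> R) :
    \sum_c F c = \sum_(i < m) F (inl i) + \sum_(i < m.+1) F (inr i).
  by rewrite big_sumType.
pose e (c : 'I_m + 'I_m.+1) : R := if c is inl _ then t / a else - (t / b).
pose h (p : 'I_q * bool) (c : 'I_m + 'I_m.+1) : R := match c with
  inl i => r1 * harmonic R m p.1.+1 p.2 i
| inr i => r2 * harmonic R m.+1 p.1.+1 p.2 i end.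
have qm' : (q.*2 < m.+1)%N by rewrite ltnS ltnW.
have [|||p p'|c|G Gt Gz] := @odd_frame q (m + m.+1) ('I_m + 'I_m.+1)%type e h.
- by rewrite card_sum !card_ord.
- rewrite sumS /= !sumr_const !card_ord -[_ *+ m]mulr_natr -[_ *+ m.+1]mulr_natr -aE -bE' sqrrN !exprMn !exprVn t2.
  by field; rewrite ?a0 ?b0 ?ab0.
- by move=> p; rewrite sumS /= -!mulr_sumr !sum_harmonics // !mulr0 addr0.
- rewrite sumS /=; under eq_bigr do rewrite mulrACA -expr2 r12.
  under [X in _ + X]eq_bigr do rewrite mulrACA -expr2 r22.
  rewrite -!mulr_sumr !harmonics_orthogonal // -aE -bE' -mulrA.
  rewrite !mulrA -mulrDl (_ : _ + _ = 1) ?mul1r // x1E x2E KE.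
  by field; rewrite ?a0 ?b0 ?ab0 ?q0'.
- rewrite NE; case: c => i /=; rewrite sum_harmonics_sqr ?r12 ?r22 ?sqrrN.
    by rewrite /x1 -/K; field; rewrite ?a0 ?b0 ?ab0 ?q0'.
  by rewrite /x2 -/K; field; rewrite ?a0 ?b0 ?ab0 ?q0'.
exists G => //; apply: Gz => [|p]; rewrite sumS /=.
  by rewrite !sumr_const !card_ord -[_ *+ m]mulr_natr -[_ *+ m.+1]mulr_natr -aE -bE'; field; rewrite ?a0 ?b0 ?ab0.
by rewrite -!mulr_sumr !sum_harmonics // !mulr0 addr0.
Qed.

Lemma zero_sumP k N (G : 'M[R]_(k, N)) :
  zero_sum G <-> G *m (const_mx 1 : 'rV[R]_N)^T = 0.
Proof.
have E a : (G *m (const_mx 1 : 'rV[R]_N)^T) a 0 = \sum_i G a i.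
  by rewrite mxE; apply: eq_bigr => i _; rewrite !mxE mulr1.
split=> [G0|G0 a]; last by rewrite -E G0 mxE.
by apply/matrixP => a j; rewrite !ord1 E G0 mxE.
Qed.

Lemma constant_unit_row N : (0 < N)%N ->
  let w := (Num.sqrt (N%:R : R))^-1 *: (const_mx 1 : 'rV[R]_N) in w *m w^T = 1%:M.
Proof.
move=> N0 w; rewrite dot_mx dotZl dotZr mulrA -expr2 exprVn sqr_sqrtr //.
rewrite /dot (eq_bigr (fun=> 1)) => [|j _]; last by rewrite mxE mulr1.
by rewrite sumr_const card_ord mulVf // pnatr_eq0 -lt0n.
Qed.

(** Complete [G] together with the normalized constant row: the new rows are
    orthogonal to that row, which accounts for the subtracted matrix. *)
Lemma zero_sum_complete k d N (G : 'M[R]_(k, N)) : (k + d).+1 = N ->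
  G *m G^T = 1%:M -> zero_sum G ->
  exists G' : 'M[R]_(d, N), [/\ G' *m G'^T = 1%:M, G *m G'^T = 0, zero_sum G' &
    G^T *m G + G'^T *m G' = 1%:M - const_mx N%:R^-1].
Proof.
move=> kdN GG /zero_sumP G0; have N0 : (0 < N)%N by rewrite -kdN.
have := constant_unit_row N0; set w := _ *: _ => /= ww.
have Gw : G *m w^T = 0 by rewrite linearZ /= -scalemxAr G0 scaler0.
have wG : w *m G^T = 0 by rewrite -[LHS]trmxK trmx_mul trmxK Gw trmx0.
have [||G' [G'G']] := @orthogonal_complete R (1 + k) d N (col_mx w G).
- by rewrite -kdN.
- by rewrite tr_col_mx mul_col_row ww Gw wG GG -scalar_mx_block.
rewrite mul_col_mx => /eqP; rewrite col_mx_eq0 => /andP[/eqP wG' /eqP GG'].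
rewrite tr_col_mx mul_row_col => compl.
exists G'; split => //.
  apply/zero_sumP; have : G' *m w^T = 0 by rewrite -[LHS]trmxK trmx_mul trmxK wG' trmx0.
  rewrite linearZ /= -scalemxAr => /eqP; rewrite scaler_eq0 invr_eq0 sqrtr_eq0.
  by rewrite leNgt ltr0n N0 /= => /eqP.
have wwE : w^T *m w = const_mx N%:R^-1.
  apply/matrixP => i j; rewrite mxE big_ord1 !mxE !mulr1 -expr2 exprVn sqr_sqrtr //.
by rewrite -compl -wwE -(addrA (w^T *m w)) [RHS]addrAC subrr add0r.
Qed.

Lemma col_norms k N (G : 'M[R]_(k, N)) i : \sum_a G a i ^+ 2 = (G^T *m G) i i.
Proof. by rewrite mxE; apply: eq_bigr => a _; rewrite mxE expr2. Qed.

Lemma zero_sum_frame_complement k d N (G : 'M[R]_(k, N)) : (k + d).+1 = N ->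
  tight_frame G -> zero_sum G -> exists2 G' : 'M[R]_(d, N), tight_frame G' & zero_sum G'.
Proof.
move=> kdN [GG Gn] G0.
have [G' [G'G' _ G'0 compl]] := zero_sum_complete kdN GG G0.
exists G' => //; split => // i.
have NR : (0 : R) < N%:R by rewrite -kdN ltr0n.
have dE : d%:R = N%:R - 1 - k%:R :> R by rewrite -kdN -[(k + d).+1%:R]natr1 natrD; ring.
have := congr1 (fun A : 'M[R]_N => A i i) compl.
rewrite [LHS]mxE -!col_norms Gn [RHS]mxE !mxE eqxx.
by move=> /(canRL (addKr _)) ->; rewrite mulr1n dE; field; rewrite gt_eqF.
Qed.

(** With [N = n + 1]: for even [k] the harmonics suffice; for odd [k] and even
    [N] the alternating row is added. For odd [k] and odd [N] there is no such
    row; then two blocks of sizes [n / 2] and [n / 2 + 1] work if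
    [3 <= k <= n / 2], and the complement within the zero-sum vectors reduces
    the remaining [k <= n - 3] to that case, as [n - k] is odd again. *)
Lemma zero_sum_frame_exists n k : (0 < k < n)%N ->
  odd n \/ (k != 1 /\ k != n.-1)%N ->
  exists2 G : 'M[R]_(k, n.+1), tight_frame G & zero_sum G.
Proof.
move=> /andP[k0 kn] nk.
case: (boolP (odd k)) => kodd; last first.
  have -> : k = (k./2).*2 by move: kodd; lia.
  by apply: even_frame; move: kodd; lia.
have two_blocks l : odd l -> (1 < l)%N -> ~~ odd n -> (l.*2 <= n)%N ->
    exists2 G : 'M[R]_(l, n.+1), tight_frame G & zero_sum G.
  move=> lodd l1 nev ln.
  have -> : l = (l./2).*2.+1 by move: lodd; lia.
  have -> : n.+1 = (n./2 + (n./2).+1)%N by move: nev; lia.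
  by apply: two_block_frame; lia.
case: (boolP (odd n)) nk => [nodd _|nev [//|[k1 kn1]]].
  have -> : k = (k./2).*2.+1 by move: kodd; lia.
  have -> : n.+1 = (n.+1./2).*2 by move: nodd; lia.
  by apply: alternating_frame; lia.
have [kn2|kn2] := leqP k.*2 n; first by apply: two_blocks => //; lia.
have [|||G Gt G0] := two_blocks (n - k)%N _ _ nev; try lia.
by apply: zero_sum_frame_complement Gt G0; lia.
Qed.

End TightFrames.

(** * The slab of an extremal projection *)

Section Slab.
Variables (R : realType) (n k : nat) (A : 'M[R]_(k, n)) (r : R).

(** Every subset of the unit ball with projection in the ball of radius [r] of
    the row space of [A] lies in the slab, which makes it the hub of the
    family: extremal bodies can be joined through it. *)
Definition slab : set 'rV[R]_n := [set x | enorm x <= 1 /\ enorm (x *m A^T) <= r].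

Definition extremal_body (K : set 'rV[R]_n) : Prop :=
  [/\ compact K, convex_set K, K `<=` slab & john_position K].

Lemma convex_setP (K : set 'rV[R]_n) : convex_set K <->
  forall x y t, 0 <= t <= 1 -> K x -> K y -> K (t *: x + (1 - t) *: y).
Proof.
split=> [Kconv x y t /andP[t0 t1] Kx Ky|Kconv x y t].
  have := Kconv x y (Itv01 t0 t1); rewrite !inE; exact.
by rewrite !inE => Kx Ky; apply: Kconv => //; rewrite ge0 le1.
Qed.

Lemma slab_sub_ball : slab `<=` unit_ball R n.
Proof. by move=> x []. Qed.

Lemma compact_slab : compact slab.
Proof.
apply: bounded_closed_compact; first exact/bounded_ball/slab_sub_ball.
have -> : slab = (fun x : 'rV[R]_n => enorm (x *m 1%:M)) @^-1` [set x | x <= 1] `&`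
                 (fun x : 'rV[R]_n => enorm (x *m A^T)) @^-1` [set x | x <= r].
  by apply/seteqP; split => x; rewrite /slab /= mulmx1.
apply: closedI.
  by apply: preimage_closed (@closed_le _ 1) => x _; exact: continuous_enorm_mulmxr.
by apply: preimage_closed (@closed_le _ r) => x _; exact: continuous_enorm_mulmxr.
Qed.

Lemma conv_hull_sub_slab (I : finType) (p : I -> 'rV[R]_n) :
  (forall i, slab (p i)) -> conv_hull p `<=` slab.
Proof.
move=> ps x px; split.
  rewrite -[x]mulmx1; apply: enorm_conv_hull px => i.
  by rewrite mulmx1; case: (ps i).
by apply: enorm_conv_hull px => i; case: (ps i).
Qed.

Lemma convex_conv_hull (I : finType) (p : I -> 'rV[R]_n) : convex_set (conv_hull p).
Proof.
apply/convex_setP => _ _ t /andP[t0 t1] [w [w0 w1 ->]] [v [v0 v1 ->]].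
exists (fun i => t * w i + (1 - t) * v i); split.
- by move=> i; rewrite addr_ge0 ?mulr_ge0 ?subr_ge0.
- by rewrite big_split /= -!mulr_sumr w1 v1 !mulr1 addrC subrK.
- rewrite !scaler_sumr -big_split; apply: eq_bigr => i _.
  by rewrite /= !scalerA -scalerDl.
Qed.

Lemma extremal_conv_hull (I : finType) (p : I -> 'rV[R]_n) (lam : I -> R) :
  (forall i, 0 <= lam i) -> \sum_i lam i = n%:R -> \sum_i lam i *: p i = 0 ->
  \sum_i lam i *: ((p i)^T *m p i) = 1%:M -> (forall i, slab (p i)) ->
  extremal_body (conv_hull p).
Proof.
move=> lam0 lamn lamp lampp ps; split.
- exact: compact_conv_hull.
- exact: convex_conv_hull.
- exact: conv_hull_sub_slab.
- by exists I, p, lam; split.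
Qed.

End Slab.

(** * Extremal cross-polytopes and simplices *)

Section Bodies.
Variables (R : realType) (n k : nat).

Lemma sqrtr_nat_ratio : 0 <= k%:R / n%:R :> R.
Proof. by rewrite divr_ge0. Qed.

(** With [W = G^T A + G'^T A'], for an orthogonal matrix with the row blocks
    [A] and [A'], the rows of [W] are the columns of the block column
    [(G; G')] written in the basis given by [A] and [A'], in which projecting
    to the row space of [A] leaves the columns of [G]. This puts the
    cross-polytope and the simplex into positions that are extremal for the same
    subspace. *)
Lemma frame_transport d N (A : 'M[R]_(k, n)) (G : 'M[R]_(k, N)) (G' : 'M[R]_(d, N)) :
  (k + d)%N = n -> A *m A^T = 1%:M ->
  G *m G^T = 1%:M -> G' *m G'^T = 1%:M -> G *m G'^T = 0 ->
  exists W : 'M[R]_(N, n), [/\ W *m A^T = G^T, W^T *m W = 1%:M &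
    W *m W^T = G^T *m G + G'^T *m G'].
Proof.
move=> kdn AA GG G'G' GG'.
have [A' [A'A' AA' compl]] := orthogonal_complete kdn AA.
have A'A : A' *m A^T = 0 by rewrite -[LHS]trmxK trmx_mul trmxK AA' trmx0.
have G'G : G' *m G^T = 0 by rewrite -[LHS]trmxK trmx_mul trmxK GG' trmx0.
pose H := col_mx G G'; pose B := col_mx A A'.
have WE : H^T *m B = G^T *m A + G'^T *m A' by rewrite tr_col_mx mul_row_col.
have HH : H *m H^T = 1%:M.
  by rewrite tr_col_mx mul_col_row GG GG' G'G G'G' -scalar_mx_block.
have BB : B *m B^T = 1%:M.
  by rewrite tr_col_mx mul_col_row AA AA' A'A A'A' -scalar_mx_block.
exists (H^T *m B); split.
- by rewrite WE mulmxDl -!mulmxA AA A'A mulmx1 mulmx0 addr0.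
- rewrite trmx_mul trmxK mulmxA -[_ *m H *m _]mulmxA HH mulmx1.
  by rewrite tr_col_mx mul_row_col.
- rewrite trmx_mul trmxK mulmxA -[_ *m B *m _]mulmxA BB mulmx1.
  by rewrite tr_col_mx mul_row_col.
Qed.

Lemma sum_outer_rows N (W : 'M[R]_(N, n)) : \sum_i (row i W)^T *m row i W = W^T *m W.
Proof.
apply/matrixP => a b; rewrite summxE mxE; apply: eq_bigr => i _.
by rewrite mxE big_ord1 !mxE.
Qed.

Lemma dot_row_frame N (A : 'M[R]_(k, n)) (G : 'M[R]_(k, N)) (W : 'M[R]_(N, n)) i :
  W *m A^T = G^T -> dot (row i W *m A^T) (row i W *m A^T) = \sum_a G a i ^+ 2.
Proof. by move=> WA; rewrite -row_mul WA; apply: eq_bigr => a _; rewrite !mxE expr2. Qed.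

Hypothesis n0 : (0 < n)%N.
Let nR : (0 : R) < n%:R. Proof. by rewrite ltr0n. Qed.
Let r : R := Num.sqrt (k%:R / n%:R).

(** Complete a tight frame [G] of [n] vectors in dimension [k] to an orthogonal
    matrix: its columns span the cross-polytope, and each of them has a
    projection of length [sqrt (k / n)]. *)
Lemma extremal_crosspolytope (A : 'M[R]_(k, n)) : (0 < k < n)%N -> A *m A^T = 1%:M ->
  exists2 K, is_regular_crosspolytope K & extremal_body A r K.
Proof.
move=> kn AA; have [G [GG Gn]] := @tight_frame_exists R k n kn.
have kn' : (k + (n - k))%N = n by rewrite subnKC // ltnW //; case/andP: kn.
have [G' [G'G' GG' compl]] := orthogonal_complete kn' GG.
have [W [WA WW WW']] := frame_transport kn' AA GG G'G' GG'.
rewrite compl in WW'.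
exists (conv_hull (fun ib : 'I_n * bool => 0 + ((-1) ^+ ib.2 * 1) *: row ib.1 W)).
  by exists W, 0, 1.
have pairE (V : nmodType) (F : 'I_n -> bool -> V) :
    \sum_(ib : 'I_n * bool) F ib.1 ib.2 = \sum_i (F i true + F i false).
  rewrite -(pair_bigA _ F) /=; apply: eq_bigr => i _; exact: big_bool.
apply: (@extremal_conv_hull _ _ _ _ _ _ _ (fun=> 2^-1)).
- by move=> _; rewrite invr_ge0.
- rewrite (pairE _ (fun _ _ => 2^-1)) (eq_bigr (fun=> 1)) => [|i _]; last by field.
  by rewrite sumr_const card_ord.
- rewrite (pairE _ (fun i (b : bool) => 2^-1 *: (0 + ((-1) ^+ b * 1) *: row i W))).
  by rewrite big1 // => i _; rewrite !add0r expr1 expr0 !mulr1 scaleN1r scale1r scalerN addNr.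
- rewrite (pairE _ (fun i (b : bool) => 2^-1 *:
     ((0 + ((-1) ^+ b * 1) *: row i W)^T *m (0 + ((-1) ^+ b * 1) *: row i W)))).
  rewrite -WW -sum_outer_rows; apply: eq_bigr => i _.
  have outer (b : bool) : (0 + ((-1) ^+ b * 1) *: row i W)^T *m (0 + ((-1) ^+ b * 1) *: row i W) =
      (row i W)^T *m row i W.
    by rewrite add0r mulr1 [(_ *: _)^T]linearZ /= -scalemxAl -scalemxAr scalerA -expr2 sqrr_sign scale1r.
  rewrite !outer.
  by rewrite -scalerDl (_ : 2^-1 + 2^-1 = 1) ?scale1r //; field.
- move=> [i b]; rewrite /slab /= add0r mulr1 -scalemxAl !enormZ normrX normrN1 expr1n !mul1r.
  rewrite !enorm_le ?sqrtr_ge0 // expr1n dot_row WW' mxE eqxx; split => //.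
  by rewrite (dot_row_frame _ WA) Gn sqr_sqrtr // sqrtr_nat_ratio.
Qed.

(** Complete a zero-sum tight frame [G] of [n + 1] vectors to an orthonormal
    basis of the zero-sum vectors: its [n + 1] columns, scaled by
    [s = sqrt ((n + 1) / n)] to unit length, are the vertices. *)
Lemma extremal_simplex (A : 'M[R]_(k, n)) : (0 < k < n)%N -> A *m A^T = 1%:M ->
  odd n \/ (k != 1 /\ k != n.-1)%N ->
  exists2 K, is_regular_simplex K & extremal_body A r K.
Proof.
move=> kn AA par; have [G [GG Gn] G0] := @zero_sum_frame_exists R n k kn par.
have kn' : (k + (n - k))%N = n by rewrite subnKC // ltnW //; case/andP: kn.
have kn'' : (k + (n - k)).+1 = n.+1 by rewrite kn'.
have [G' [G'G' GG' G'0 compl]] := zero_sum_complete kn'' GG G0.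
have [W [WA WW WW']] := frame_transport kn' AA GG G'G' GG'.
rewrite compl in WW'.
pose s : R := Num.sqrt (n.+1%:R / n%:R).
have NE : n.+1%:R = n%:R + 1 :> R by rewrite -natr1.
have s2 : s ^+ 2 = (n%:R + 1) / n%:R by rewrite sqr_sqrtr ?NE // divr_ge0 // addr_ge0.
have s0 : 0 <= s by exact: sqrtr_ge0.
have dotp i j : dot (s *: row i W) (s *: row j W) = s ^+ 2 * ((i == j)%:R - n.+1%:R^-1).
  by rewrite dotZl dotZr mulrA -expr2 dot_row WW' !mxE.
have cC : (const_mx 1 : 'rV[R]_n.+1) *m const_mx n.+1%:R^-1 = const_mx 1 :> 'rV[R]_n.+1.
  apply/matrixP => i j; rewrite !mxE (eq_bigr (fun=> n.+1%:R^-1)) => [|l _].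
    by rewrite sumr_const card_ord -[LHS]mulr_natr mulVf // pnatr_eq0.
  by rewrite !mxE mul1r.
have sumW : \sum_i row i W = 0.
  have W1 : const_mx 1 *m W = 0 :> 'rV_n.
    apply/eqP; rewrite -dot_eq0 dotE trmx_mul mulmxA -[const_mx 1 *m W *m _]mulmxA WW'.
    by rewrite mulmxBr mulmx1 cC subrr mul0mx mxE.
  rewrite -[RHS]W1 mulmx_sum_row; apply: eq_bigr => i _; by rewrite mxE scale1r.
exists (conv_hull (fun i => s *: row i W)).
  exists (fun i => s *: row i W), (Num.sqrt (2 * s ^+ 2)); split => //.
    by rewrite sqrtr_gt0 mulr_gt0 // s2 divr_gt0 // addr_gt0.
  move=> i j ij; rewrite /enorm dotB !dotp !eqxx (negbTE ij).
  by congr Num.sqrt; rewrite mulr0n mulr1n; ring.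
apply: (@extremal_conv_hull _ _ _ _ _ _ _ (fun=> n%:R / n.+1%:R)).
- by move=> _; rewrite divr_ge0.
- by rewrite sumr_const card_ord -[LHS]mulr_natr divfK // pnatr_eq0.
- by rewrite -scaler_sumr -scaler_sumr sumW !scaler0.
- rewrite -scaler_sumr (eq_bigr (fun i => s ^+ 2 *: ((row i W)^T *m row i W))) => [|i _].
    rewrite -scaler_sumr sum_outer_rows WW scalerA s2 NE.
    rewrite (_ : _ * _ = 1) ?scale1r //; field.
    by rewrite !gt_eqF // addr_gt0.
  by rewrite [(_ *: _)^T]linearZ /= -scalemxAl -scalemxAr scalerA -expr2.
- move=> i; split.
    rewrite enorm_le // expr1n dotp eqxx mulr1n s2 NE le_eqVlt; apply/orP; left; apply/eqP.
    by field; rewrite !gt_eqF // addr_gt0.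
  rewrite enorm_le ?sqrtr_ge0 // -scalemxAl dotZl dotZr (dot_row_frame _ WA) Gn.
  rewrite sqr_sqrtr ?sqrtr_nat_ratio // mulrA -expr2 s2 NE le_eqVlt; apply/orP; left; apply/eqP.
  by field; rewrite !gt_eqF // addr_gt0.
Qed.

End Bodies.

(** * Extremal cubes *)

Section Cube.
Variables (R : realType) (n k : nat).
Hypothesis n0 : (0 < n)%N.

Definition sign_vector (f : {ffun 'I_n -> bool}) : 'rV[R]_n := \row_j (-1) ^+ f j.

(** Flipping the sign at [j] pairs off the terms of the sum. *)
Lemma sum_flip (j : 'I_n) (F : {ffun 'I_n -> bool} -> R) :
  (forall f : {ffun 'I_n -> bool}, F [ffun l => if l == j then ~~ f l else f l] = - F f) -> \sum_f F f = 0.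
Proof.
move=> Fflip; pose flip (f : {ffun 'I_n -> bool}) := [ffun l => if l == j then ~~ f l else f l].
have flipK : involutive flip.
  by move=> f; apply/ffunP => l; rewrite !ffunE; case: (l == j); rewrite ?negbK.
have : \sum_f F f = - \sum_f F f.
  rewrite {1}(reindex_inj (inv_inj flipK)) -sumrN.
  by apply: eq_bigr => f _; exact: Fflip.
lra.
Qed.

(** The vertices of the cube, all with the same weight, satisfy John's
    condition, and dropping coordinates leaves [k] entries of modulus at most
    [1 / sqrt n]. *)
Lemma extremal_cube : (k <= n)%N ->
  exists2 K, is_cube K &
    extremal_body (pid_mx k : 'M[R]_(k, n)) (Num.sqrt (k%:R / n%:R)) K.
Proof.
move=> kn; have nR : (0 : R) < n%:R by rewrite ltr0n.
pose s : R := (Num.sqrt n%:R)^-1.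
have s0 : 0 < s by rewrite invr_gt0 sqrtr_gt0.
have s2 : s ^+ 2 = n%:R^-1 by rewrite exprVn sqr_sqrtr // ltW.
pose Q := [set x : 'rV[R]_n | forall j, `|x ord0 j| <= s].
have sqQ x j : Q x -> x ord0 j ^+ 2 <= n%:R^-1.
  by move=> /(_ j) xj; rewrite -s2 -real_normK ?num_real // ler_sqr ?nnegrE ?(ltW s0).
exists Q.
  exists 1%:M, 0, s; split => //; first by rewrite trmx1 mulmx1.
  by apply/seteqP; split => [x Qx|_ [x Qx <-]]; [exists x|]; rewrite ?mulmx1 ?add0r.
split.
- have -> : Q = [set x | forall j, `[- s, s]%classic (x ord0 j)].
    by apply/seteqP; split => x Qx j; have := Qx j; rewrite /= in_itv /= ler_norml.
  exact: (@rV_compact R _ (fun=> `[- s, s]%classic) (fun=> @segment_compact R (- s) s)).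
- apply/convex_setP => x y t /andP[t0 t1] Qx Qy j; rewrite !mxE.
  have t1' : 0 <= 1 - t by rewrite subr_ge0.
  apply: le_trans (ler_normD _ _) _; rewrite !normrM (ger0_norm t0) (ger0_norm t1').
  rewrite [leRHS](_ : s = t * s + (1 - t) * s); last by ring.
  by apply: lerD; apply: ler_wpM2l.
- move=> x Qx; split.
    rewrite enorm_le // expr1n; apply: le_trans (_ : \sum_(j < n) n%:R^-1 <= _).
      by apply: ler_sum => j _; rewrite -expr2 sqQ.
    by rewrite sumr_const card_ord -[leLHS]mulr_natr mulVf // gt_eqF.
  rewrite enorm_le ?sqrtr_ge0 // sqr_sqrtr ?divr_ge0 //.
  apply: le_trans (_ : \sum_(j < k) n%:R^-1 <= _); last first.
    by rewrite sumr_const card_ord -[leLHS]mulr_natr mulrC.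
  apply: ler_sum => j _; rewrite -expr2.
  have -> : (x *m (pid_mx k : 'M[R]_(k, n))^T) ord0 j = x ord0 (widen_ord kn j).
    rewrite tr_pid_mx mxE (bigD1 (widen_ord kn j)) //= big1 => [|i ij]; last first.
      rewrite mxE; have /negbTE -> : (i : nat) != j by move: ij; rewrite -val_eqE.
      by rewrite mulr0.
    by rewrite mxE eqxx /= ltn_ord mulr1 addr0.
  exact: sqQ.
exists {ffun 'I_n -> bool}, (fun f => s *: sign_vector f), (fun=> n%:R / (2 ^ n)%:R).
have card2 : #|{ffun 'I_n -> bool}| = (2 ^ n)%N by rewrite card_ffun card_bool card_ord.
have pow0 : (2 ^ n)%:R != 0 :> R by rewrite pnatr_eq0 expn_eq0.
split.
- by move=> _; rewrite divr_ge0.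
- by rewrite sumr_const card2 -[LHS]mulr_natr divfK.
- rewrite -!scaler_sumr; have -> : \sum_f sign_vector f = 0.
    apply/rowP => j; rewrite summxE mxE; apply: (@sum_flip j) => f.
    by rewrite !mxE ffunE eqxx; case: (f j) => /=; rewrite ?expr0 ?expr1 ?opprK.
  by rewrite !scaler0.
- apply/matrixP => i j; rewrite summxE.
  rewrite (eq_bigr (fun f : {ffun 'I_n -> bool} =>
     (n%:R / (2 ^ n)%:R * s ^+ 2) * ((-1) ^+ f i * (-1) ^+ f j))) => [|f _]; last first.
    by rewrite !mxE big_ord1 !mxE; ring.
  rewrite -mulr_sumr s2 !mxE; have [<-|ij] := eqVneq i j.
    rewrite (eq_bigr (fun=> 1)) => [|f _]; last by rewrite -expr2 sqrr_sign.
    by rewrite sumr_const card2 mulr1n; field; rewrite pow0 gt_eqF.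
  rewrite (@sum_flip i) ?mulr0 // => f.
  by rewrite !ffunE eqxx eq_sym (negbTE ij); case: (f i) => /=; rewrite ?expr0 ?expr1; ring.
- move=> x [w [w0 w1 ->]] j; rewrite summxE.
  apply: le_trans (ler_norm_sum _ _ _) _; rewrite -[leRHS]mul1r -w1 mulr_suml.
  apply: ler_sum => f _; rewrite !mxE !normrM normrX normrN1 expr1n mulr1.
  by rewrite (ger0_norm (w0 f)) (gtr0_norm s0).
Qed.

End Cube.

(** * The continuous family *)

Section Interpolation.
Variables (R : realType) (n k : nat) (A : 'M[R]_(k, n)).
Hypotheses (n0 : (0 < n)%N) (k0 : (0 < k)%N) (AA : A *m A^T = 1%:M).
Let r : R := Num.sqrt (k%:R / n%:R).
Variables (Q0 Q1 Q2 : set 'rV[R]_n).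
Hypotheses (Q0e : extremal_body A r Q0) (Q1e : extremal_body A r Q1)
  (Q2e : extremal_body A r Q2).

Definition tent (x : R) : R := Num.max 0 (1 - 2 * `|x|).

Lemma tent_ge0 x : 0 <= tent x. Proof. by rewrite /tent le_max lexx. Qed.

Lemma tent_eq0 x : 2^-1 <= `|x| -> tent x = 0.
Proof. by move=> h; rewrite /tent max_l //; lra. Qed.

Lemma tent_le1 x : tent x <= 1.
Proof. by rewrite /tent ge_max ler01 /=; have := normr_ge0 x; lra. Qed.

Lemma tent_lipschitz x y : `|tent x - tent y| <= 2 * `|x - y|.
Proof.
have h1 : `|x| <= `|y| + `|x - y| by rewrite -{1}(subrK y x) addrC ler_normD.
have h2 : `|y| <= `|x| + `|x - y|.
  by rewrite -{1}(subrK x y) addrC (distrC x) ler_normD.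
have h3 : 0 <= `|x - y| by [].
rewrite ler_norml /tent.
by case: (leP 0 (1 - 2 * `|x|)) => ?; case: (leP 0 (1 - 2 * `|y|)) => ?; apply/andP; split; lra.
Qed.

Definition weight (t : R) (i : nat) : R :=
  if (i < 3)%N then tent (t - i%:R) else 1 - \sum_(j < 3) tent (t - j%:R).

Definition bodies (i : nat) : set 'rV[R]_n :=
  match i with 0 => Q0 | 1 => Q1 | 2 => Q2 | _ => slab A r end.

(** At the times 0, 1, 2 the path is at [Q0], [Q1], [Q2]; in between each of
    them grows to the slab, which contains them all, and the slab shrinks to the
    next one. *)
Definition body_path (t : R) : set 'rV[R]_n := mink 4 (weight t) bodies.

(** The tent around the nearest integer is the only one that can be nonzero. *)
Lemma at_most_one_tent t : exists2 i : nat, (i < 3)%N &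
  forall j : nat, (j < 3)%N -> j != i -> tent (t - j%:R) = 0.
Proof.
have far (i : nat) : 2^-1 <= t - i%:R \/ 2^-1 <= - (t - i%:R) -> tent (t - i%:R) = 0.
  by move=> h; apply: tent_eq0; rewrite ler_normr; apply/orP.
have big3 (P : nat -> Prop) : P 0 -> P 1 -> P 2 -> forall j, (j < 3)%N -> P j.
  by move=> P0 P1 P2 [|[|[|]]].
have [t1|t1] := leP t 2^-1.
  by exists 0%N => //; apply: big3 => // _; apply: far; right; lra.
have [t2|t2] := leP t (3 / 2).
  exists 1%N => //; apply: big3 => // _; apply: far; first by left; lra.
  by right; lra.
by exists 2%N => //; apply: big3 => // _; apply: far; left; lra.
Qed.

Lemma weight_ge0 t i : 0 <= weight t i.
Proof.
rewrite /weight; case: ifP => _; first exact: tent_ge0.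
have [i0 i03 h] := at_most_one_tent t.
rewrite (bigD1 (Ordinal i03)) //= big1 => [|j ji]; last exact: h.
by rewrite addr0 subr_ge0 tent_le1.
Qed.

Lemma sum_weight t : \sum_(i < 4) weight t i = 1.
Proof.
rewrite big_ord_recr /=.
have -> : \sum_(i < 3) weight t i = \sum_(i < 3) tent (t - i%:R).
  by apply: eq_bigr => i _; rewrite /weight ltn_ord.
by rewrite /weight /= addrC subrK.
Qed.

(** Each of the three tents contributes 2 to the constant, and 2 more through
    the last weight. *)
Lemma weight_lipschitz s t : \sum_(i < 4) `|weight s i - weight t i| <= 12 * `|s - t|.
Proof.
have tl (i : 'I_3) : `|tent (s - i%:R) - tent (t - i%:R)| <= 2 * `|s - t|.
  apply: le_trans (tent_lipschitz _ _) _.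
  by rewrite (_ : _ - _ - _ = s - t) //; ring.
have sl : \sum_(i < 3) `|tent (s - i%:R) - tent (t - i%:R)| <= 6 * `|s - t|.
  apply: le_trans (ler_sum _ (fun i _ => tl i)) _.
  by rewrite sumr_const card_ord -[leLHS]mulr_natr; lra.
rewrite big_ord_recr /= (_ : 12 * _ = 6 * `|s - t| + 6 * `|s - t|); last by ring.
apply: lerD.
  apply: le_trans sl; rewrite le_eqVlt; apply/orP; left; apply/eqP.
  by apply: eq_bigr => i _; rewrite /weight ltn_ord.
have -> : weight s 3 - weight t 3 =
    \sum_(i < 3) (tent (t - i%:R) - tent (s - i%:R)).
  by rewrite /weight /= sumrB; ring.
apply: le_trans (ler_norm_sum _ _ _) _; apply: le_trans sl.
by apply: ler_sum => i _; rewrite distrC.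
Qed.

Lemma body_sub i : bodies i `<=` slab A r.
Proof. by case: i => [|[|[|i]]] //=; [case: Q0e|case: Q1e|case: Q2e]. Qed.

Lemma extremal_nonempty Q : extremal_body A r Q -> Q !=set0.
Proof.
case=> _ _ Qs Qj; exists 0; apply: john_position_ball Qj _ => //.
  by move=> x /Qs; exact: slab_sub_ball.
by rewrite enorm0 invr_ge0.
Qed.

Lemma body_nonempty i : bodies i !=set0.
Proof.
have [x Qx] := extremal_nonempty Q0e.
case: i => [|[|[|i]]] /=; [exact: extremal_nonempty Q0e|exact: extremal_nonempty Q1e|
  exact: extremal_nonempty Q2e|by exists x; exact: (@body_sub 0)].
Qed.

Lemma body_compact i : compact (bodies i).
Proof. by case: i => [|[|[|i]]] /=; [case: Q0e|case: Q1e|case: Q2e|exact: compact_slab]. Qed.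

Lemma convex_slab : convex_set (slab A r).
Proof.
apply/convex_setP => x y t /andP[t0 t1] [x1 x2] [y1 y2].
have t1' : 0 <= 1 - t by rewrite subr_ge0.
have bound m (u v : 'rV[R]_m) c : enorm u <= c -> enorm v <= c ->
    enorm (t *: u + (1 - t) *: v) <= c.
  move=> uc vc; apply: le_trans (enorm_triangle _ _) _; rewrite !enormZ !ger0_norm //.
  rewrite [leRHS](_ : c = t * c + (1 - t) * c); last by ring.
  by apply: lerD; apply: ler_wpM2l.
by split; rewrite ?mulmxDl -?scalemxAl; apply: bound.
Qed.

Lemma body_convex i : convex_set (bodies i).
Proof. by case: i => [|[|[|i]]] /=; [case: Q0e|case: Q1e|case: Q2e|exact: convex_slab]. Qed.

Lemma path_convex t : convex_set (body_path t).
Proof.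
apply/convex_setP => _ _ c c01 [p Qp ->] [q Qq ->].
exists (fun i => c *: p i + (1 - c) *: q i) => [i i4|].
  by have /convex_setP := @body_convex i; apply => //; [exact: Qp|exact: Qq].
rewrite !scaler_sumr -big_split; apply: eq_bigr => i _ /=.
by rewrite scalerDr !scalerA [c * _]mulrC [(1 - c) * _]mulrC.
Qed.

Lemma path_sub_slab t : body_path t `<=` slab A r.
Proof.
move=> _ [q Qq ->]; pose q' (i : 'I_4) := q i.
have h : conv_hull q' (\sum_(i < 4) weight t i *: q i).
  by exists (fun i : 'I_4 => weight t i); split => // [i|]; [exact: weight_ge0|exact: sum_weight].
by apply: conv_hull_sub_slab h => i; apply/body_sub/Qq.
Qed.

(** If only [i] and the slab have a nonzero weight, a point of the [i]-th body,
    being in the slab too, is a combination of itself with itself. *)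
Lemma body_sub_path t : exists2 i, (i < 3)%N & bodies i `<=` body_path t.
Proof.
have [i0 i03 h] := at_most_one_tent t; exists i0 => // x Qx.
exists (fun i => if (i == i0) || (i == 3) then x else get (bodies i)) => [i i4|].
  case: ifP => [/orP[/eqP -> //|/eqP ->]|_]; first exact: (@body_sub i0).
  by have [y Qy] := body_nonempty i; exact: getPex (ex_intro _ y Qy).
rewrite (eq_bigr (fun i : 'I_4 => weight t i *: x)) => [|i _].
  by rewrite -scaler_suml sum_weight scale1r.
have [->|ii0] /= := eqVneq (i : nat) i0 => //.
have [->|i3] //= := eqVneq (i : nat) 3%N.
have i3' : (i < 3)%N by move: (ltn_ord i) i3; lia.
by rewrite /weight i3' h // !scale0r.
Qed.

Lemma path_at i : (i < 3)%N -> body_path i%:R = bodies i.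
Proof.
move=> i3; have i4 : (i < 4)%N by rewrite ltnW.
have tent_at j : tent (i%:R - j%:R) = (j == i)%:R.
  have [->|ji] := eqVneq j i; first by rewrite /tent subrr normr0 mulr0 subr0 max_r.
  apply: tent_eq0; apply: (@le_trans _ _ 1); first by lra.
  rewrite -[i%:R]/(i%:Z%:~R) -[j%:R]/(j%:Z%:~R) -intrB -intr_norm ler1z.
  by have : (i%:Z - j%:Z != 0)%R; lia.
have weight_at j : (j < 4)%N -> weight i%:R j = (j == i)%:R.
  rewrite /weight ltnS leq_eqVlt => /orP[/eqP ->|j3]; last by rewrite j3 tent_at.
  rewrite ltnn gtn_eqF // (bigD1 (Ordinal i3)) //= big1 => [|l li].
    by rewrite tent_at eqxx addr0 subrr.
  by rewrite tent_at; move: li; rewrite -val_eqE => /negbTE ->.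
apply/seteqP; split=> [_ [q Qq ->]|x Qx].
  rewrite (bigD1 (Ordinal i4)) //= big1 => [|l li].
    by rewrite weight_at // eqxx scale1r addr0; exact: Qq.
  by rewrite weight_at //; move: li; rewrite -val_eqE => /negbTE ->; rewrite scale0r.
exists (fun j => if j == i then x else get (bodies j)) => [j j4|].
  case: eqP => [-> //|_].
  by have [y Qy] := body_nonempty j; exact: getPex (ex_intro _ y Qy).
rewrite (bigD1 (Ordinal i4)) //= eqxx weight_at // eqxx scale1r big1 ?addr0 // => l li.
by rewrite weight_at //; move: li; rewrite -val_eqE => /negbTE ->; rewrite scale0r.
Qed.

Lemma path_john t : john_position (body_path t).
Proof.
have [i i3 sub] := body_sub_path t.
have : john_position (bodies i) by case: i i3 sub => [|[|[|]]] //= _ _; [case: Q0e|case: Q1e|case: Q2e].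
move=> [I [u [lam [h1 h2 h3 h4 h5]]]]; exists I, u, lam; split => //.
exact: subset_trans sub.
Qed.

Lemma path_convex_body t : convex_body (body_path t).
Proof.
split.
- by apply: compact_mink => i _; exact: body_compact.
- exact: path_convex.
- apply: john_position_interior n0 _ (path_john t).
  exact: subset_trans (@path_sub_slab t) (@slab_sub_ball _ _ _ _ _).
Qed.

(** Recombine the same points with the weights at the time [t]. *)
Lemma path_near s t x : body_path s x -> exists2 y, body_path t y & enorm (x - y) <= 12 * `|s - t|.
Proof.
move=> [q Qq ->]; exists (\sum_(i < 4) weight t i *: q i); first by exists q.
rewrite -sumrB; under eq_bigr do rewrite -scalerBl.
apply: le_trans (enorm_sum_le (r := 1) _ _) _ => [i|].
  by have /body_sub[] := Qq i (ltn_ord i).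
by rewrite mulr1; exact: weight_lipschitz.
Qed.

Lemma path_hausdorff s t : 0 <= hausdorff_dist (body_path s) (body_path t) <= 12 * `|s - t|.
Proof.
set S := [set e : R | [/\ 0 <= e,
    forall x, body_path s x -> exists2 y, body_path t y & enorm (x - y) <= e &
    forall y, body_path t y -> exists2 x, body_path s x & enorm (x - y) <= e]].
have S12 : S (12 * `|s - t|).
  split; [by rewrite mulr_ge0|by move=> x; exact: path_near|move=> y /(path_near s)[x xs xy]].
  by exists x; rewrite // -enormN opprB distrC.
have lb : lbound S 0 by move=> e [].
apply/andP; split; first by apply: lb_le_inf => //; exists (12 * `|s - t|).
by apply: ge_inf => //; exists 0.
Qed.

Lemma path_continuous (D : set R) : hausdorff_continuous D body_path.
Proof.
move=> t _; have h : hausdorff_dist (body_path s) (body_path t) @[s --> t] --> (0 : R).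
  apply/cvgrPdist_le => e e0; near=> s.
  have /andP[d0 d12] := path_hausdorff s t.
  rewrite sub0r normrN ger0_norm //; apply: le_trans d12 _.
  rewrite -ler_pdivlMl // mulrC distrC.
  near: s; apply/nbhs_ballP; exists (e / 12); first by rewrite /= divr_gt0.
  by move=> s; rewrite /ball /= => /ltW.
by apply: cvg_trans h; apply: cvg_app; exact: cvg_within.
Unshelve. all: by end_near. Qed.

Lemma path_extremal (D : set R) : extremal_family k D body_path.
Proof.
have r0 : 0 < r by rewrite sqrtr_gt0 divr_gt0 ?ltr0n.
split => [t _||t _|t _].
- exact: path_convex_body.
- exact: path_continuous.
- apply: john_is_loewner (path_john t) => //.
  exact: subset_trans (@path_sub_slab t) (@slab_sub_ball _ _ _ _ _).
have [F [Fk FA]] := row_subspace AA.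
exists F, (ellipsoid 0 (r *: A)); split => //.
- move=> _ [y _ <-]; rewrite add0r -scalemxAr; apply/FA.
  by rewrite -!scalemxAl -[y *m A *m _]mulmxA AA mulmx1.
- exists F, 0, r; split => //.
  rewrite -(dilate_orth_proj_ball r AA FA) (orth_projE _ AA FA).
  apply/seteqP; split => [_ [_ [x x1 <-] <-]|_ [_ [x [x1 /FA xF] <-] <-]].
    exists (r *: (x *m A^T *m A)); last by rewrite add0r.
    exists (x *m A^T *m A) => //; split.
      move: x1; rewrite !unit_ballE dot_orthonormal //; apply: le_trans; exact: dot_proj_le.
    by apply/FA; rewrite -[_ *m A *m A^T]mulmxA AA mulmx1.
  by exists x; rewrite ?add0r //; exists x.
- rewrite (orth_projE _ AA FA) => _ [x /path_sub_slab[_ xr] <-].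
  exists (r^-1 *: (x *m A^T)); last first.
    by rewrite add0r -scalemxAr -scalemxAl scalerA divff ?gt_eqF // scale1r.
  rewrite /unit_ball /= enormZ gtr0_norm ?invr_gt0 //.
  by rewrite ler_pdivrMl // mulr1.
- exact: vol_scaled_orthonormal.
Qed.

End Interpolation.

(** * Volumes of projections in Loewner position *)

Theorem theorem1p2 (R : realType) (n k : nat)
    (hn : (2 <= n)%N) (hk : (1 <= k <= n - 1)%N) :
  (forall (K : set 'rV[R]_n) (F : {vspace 'rV[R]_n}) (E : set 'rV[R]_n),
     convex_body K -> is_loewner K (unit_ball R n) -> \dim F = k ->
     is_ellipsoid k E -> E `<=` [set` F] -> orth_proj F K `<=` E ->
     (lebesgue (dilate (Num.sqrt (k%:R / n%:R)) (unit_ball R k)) <= vol k E)%E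
     /\
     (vol k E = lebesgue (dilate (Num.sqrt (k%:R / n%:R)) (unit_ball R k)) <->
      E = dilate (Num.sqrt (k%:R / n%:R)) (orth_proj F (unit_ball R n))))
  /\
  (exists K : R -> set 'rV[R]_n,
     [/\ extremal_family k `[0, 1] K,
         exists2 t, t \in `[0, 1] & is_regular_crosspolytope (K t),
         exists2 t, t \in `[0, 1] & is_cube (K t) &
         odd n \/ (k != 1%N /\ k != (n - 1)%N) ->
         exists K' : R -> set 'rV[R]_n,
           [/\ forall t, t \in `[0, 1] -> K' t = K t,
               extremal_family k `[0, 2] K' &
               exists2 t, t \in `[0, 2] & is_regular_simplex (K' t)]]).
Proof.
have k0 : (0 < k)%N by case/andP: hk.
have n0 : (0 < n)%N by apply: leq_trans hn.
have kn : (k < n)%N by case/andP: hk => _; lia.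
split=> [K F E _|]; first exact: projection_bound.
pose A : 'M[R]_(k, n) := pid_mx k.
have AA : A *m A^T = 1%:M.
  by rewrite tr_pid_mx mul_pid_mx minnn (minn_idPr (ltnW kn)) pid_mx_1.
have k0n : (0 < k < n)%N by rewrite k0.
have [P Pcross Pe] := extremal_crosspolytope k0n AA.
have [C Ccube Ce] := @extremal_cube R n k n0 (ltnW kn).
(* Where no extremal simplex is asked for, the cube is repeated at the time 2. *)
have [S Se Ssimplex] : exists2 S, extremal_body A (Num.sqrt (k%:R / n%:R)) S &
    odd n \/ (k != 1%N /\ k != (n - 1)%N) -> is_regular_simplex S.
  have [par|par] := pselect (odd n \/ (k != 1%N /\ k != (n - 1)%N)); last by exists C.
  have [|S Ss Se] := extremal_simplex n0 k0n AA; last by exists S.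
  by rewrite -subn1.
exists (body_path A P C S).
have fam D := path_extremal n0 k0 AA Pe Ce Se D.
have stops i : (i < 3)%N -> body_path A P C S i%:R = bodies A P C S i.
  by move=> i3; exact: path_at.
split => //.
- by exists 0; rewrite ?in_itv /= ?lexx ?ler01 // (stops 0%N).
- by exists 1; rewrite ?in_itv /= ?lexx ?ler01 // (stops 1%N).
move=> par; exists (body_path A P C S); split => //.
exists 2; first by rewrite in_itv /= lexx ler0n.
by rewrite (stops 2%N) //; exact: Ssimplex.
Qed.
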